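(* Let $f:\mathbb{R}^n\rightarrow \mathbb{R}$ be a locally Lipschitz semi-algebraic function, and let $S=\{x\in\mathbb{R}^n : 0\in\partial f(x)\}$ denote its set of critical points, where $\partial f$ is the Clarke subdifferential. Assume that $S$ is a $C^2$ manifold at some $x^*\in S$ of dimension less than $n$. Assume that there exist $\theta_1 \geqslant 0$, a neighborhood $U$ of $x^*$, and a continuous function $C:\mathbb{R}^n \rightarrow \mathbb{R}$ such that for all $\alpha>0$, there exists $c_1>0$ such that for any sequence $x_0,x_1,x_2,\ldots \in U \setminus S$ generated by the subgradient method with constant step size $\alpha$, we have $$C(x_{k+1}) - C(x_k) \geqslant c_1\, d(x_k,S)^{\theta_1}\quad\text{for all } k\in \mathbb{N}.$$ Then the point $x^*$ is a strongly unstable point of $f$ if at least one of the following holds: 1) $\theta_1 = 0$; or 2) $\partial f$ is metrically $\theta_2$-subregular at $(x^*,0)$ with $\theta_2>1$, and $f$ satisfies the Verdier condition at $x^*$ along $S$.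
   Context: Let $\|\cdot\|$ be the norm induced by an inner product $\langle\cdot,\cdot\rangle$ on $\mathbb{R}^n$ (gradients, subdifferentials and orthogonal projections are taken with respect to this inner product). $B(a,r)$ denotes the closed ball of center $a$ and radius $r$, $\mathbb{N}=\{0,1,2,\ldots\}$, and $d(x,S):=\inf\{\|x-y\|: y\in S\}$. For a closed convex set (in particular a linear subspace) $T$, $P_T$ denotes the projection onto $T$. Subgradient method: for a locally Lipschitz $f:\mathbb{R}^n\to\mathbb{R}$ and constant step size $\alpha>0$, a sequence $(x_k)_{k\in\mathbb{N}}$ is generated by the subgradient method if $x_{k+1}\in x_k-\alpha\,\partial f(x_k)$ for all $k\in\mathbb{N}$, where $\partial f$ is the Clarke subdifferential. Strongly unstable point: $x^*\in\mathbb{R}^n$ is a strongly unstable point of a locally Lipschitz function $f:\mathbb{R}^n\to\mathbb{R}$ if there exists $\epsilon>0$ such that for all but finitely many constant step sizes $\alpha>0$ and for (Lebesgue) almost every initial point $x_0\in B(x^*,\epsilon)$, at least one of the iterates of the subgradient method does not belong to $B(x^*,\epsilon)$; that is, every sequence generated by the subgradient method with step size $\alpha$ from $x_0$ has at least one iterate outside $B(x^*,\epsilon)$. $C^p$ manifold at a point: a subset $S\subset\mathbb{R}^n$ is a $C^p$ manifold ($p\geqslant 1$ an integer) of dimension $m\in\mathbb{N}$ at $x\in S$ if there exist a Euclidean space $E$ of dimension $n-m$, an open neighborhood $U$ of $x$ in $\mathbb{R}^n$, and a $p$ times continuously differentiable function $\varphi:U\to E$ such that $S\cap U=\varphi^{-1}(0)$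 and whose Jacobian is surjective. The tangent cone $T_S(x)$ is then the kernel of $\varphi'(x)$ (a linear subspace). Metric $\theta$-subregularity: a set-valued mapping $F:\mathbb{R}^n\rightrightarrows\mathbb{R}^m$ is metrically $\theta$-subregular at $(\bar x,\bar y)$ with $\bar y\in F(\bar x)$ and $\theta\in\mathbb{R}$ if there exist $c>0$ and a neighborhood $U$ of $\bar x$ such that $d(x,F^{-1}(\bar y))\leqslant c\, d(\bar y,F(x))^{\theta}$ for all $x\in U$, where $F^{-1}(\bar y)=\{x:\bar y\in F(x)\}$. $C^1$ on a manifold and Riemannian gradient: let $S$ be a $C^1$ manifold at $x$. A locally Lipschitz $f:\mathbb{R}^n\to\mathbb{R}$ is $C^1$ on $S$ at $x$ if there exist a neighborhood $U$ of $x$ and a continuously differentiable $\bar f:U\to\mathbb{R}$ such that $f(y)=\bar f(y)$ for all $y\in S\cap U$. The Riemannian gradient is $\nabla_S f(x):=P_{T_S(x)}(\nabla\bar f(x))$. Verdier condition: let $f:\mathbb{R}^n\to\mathbb{R}$ be locally Lipschitz, let $S\subset\mathbb{R}^n$ be a $C^1$ manifold at $x^*$, and assume $f$ is $C^1$ on $S$ at $x^*$. Then $f$ satisfies the Verdier condition at $x^*$ along $S$ if there exist a neighborhood $U$ of $x^*$ and $c>0$ such that for all $y\in S\cap U$, $x\in U\setminus S$ and $v\in\partial f(x)$, we have $\|P_{T_S(y)}(v)-\nabla_S f(y)\|\leqslant c\|x-y\|$. *)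

(* Defs.v *)
From HB Require Import structures.
From mathcomp Require Import all_boot all_order all_algebra.
From mathcomp Require Import sesquilinear.
From mathcomp Require mpoly.
From mathcomp Require Import all_classical all_reals all_analysis.

Set Implicit Arguments.
Unset Strict Implicit.
Unset Printing Implicit Defensive.

Import Order.TTheory GRing.Theory Num.Theory.
Import numFieldNormedType.Exports.

Local Open Scope classical_set_scope.
Local Open Scope ring_scope.

(* Neighbourhoods, continuity, differentiability and local Lipschitz continuity
   refer to the library's norm on row vectors (the sup norm); as all norms on
   R^n are equivalent, they agree with those of the norm induced by the inner
   product.  Everything metric (balls, distances, projections, gradients,
   subdifferentials) is taken with respect to the inner product. *)

Section InnerProduct.
Variables (R : realType) (n : nat) (ip : {dot 'rV[R]_n for idfun}).
Implicit Types (x y v a : 'rV[R]_n) (A T : set 'rV[R]_n).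

Definition ipnorm x : R := Num.sqrt (ip x x).

Definition ipball a (r : R) : set 'rV[R]_n := [set x | ipnorm (x - a) <= r].

(* Extended-real valued, so that the distance to the empty set is +oo. *)
Definition dist x A : \bar R := ereal_inf [set (ipnorm (x - y))%:E | y in A].

(* Junk value 0 if there is no nearest point (never the case for a nonempty
   closed convex T). *)
Definition proj T v : 'rV[R]_n :=
  xget 0 [set p | T p /\ forall q, T q -> ipnorm (v - p) <= ipnorm (v - q)].

Definition gradient (g : 'rV[R]_n -> R) x : 'rV[R]_n :=
  xget 0 [set s | forall h, 'd g x h = ip s h].

End InnerProduct.

Definition locally_lipschitz (R : realType) (n : nat) (f : 'rV[R]_n -> R) :=
  forall x : 'rV[R]_n, exists k : R,
    exists2 U : set 'rV[R]_n, nbhs x U & k.-lipschitz_U f.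

(* Lebesgue outer measure zero, for n > 0: coverable by countably many boxes of
   arbitrarily small total volume. *)
Definition lebesgue_null (R : realType) (n : nat) (A : set 'rV[R]_n) :=
  forall e : R, 0 < e -> exists a b : nat -> 'rV[R]_n,
    [/\ forall k i, a k 0 i <= b k 0 i,
        A `<=` \bigcup_k [set x | forall i, a k 0 i <= x 0 i <= b k 0 i] &
        (\sum_(k <oo) (\prod_(i < n) (b k 0 i - a k 0 i))%:E <= e%:E)%E].

(* Finite unions of sets {p_1 = ... = p_r = 0, q_1 > 0, ..., q_s > 0}; each
   member of D is one pair (list of the p's, list of the q's). *)
Definition semialgebraic_set (R : realType) (n : nat) (A : set 'rV[R]_n) :=
  exists D : seq (seq (mpoly.mpoly n R) * seq (mpoly.mpoly n R)),
    A = [set x : 'rV[R]_n |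
          has (fun c => all (fun p => mpoly.meval (x 0) p == 0) c.1 &&
                        all (fun q => 0 < mpoly.meval (x 0) q) c.2) D].

Definition semialgebraic_fun (R : realType) (n : nat) (f : 'rV[R]_n -> R) :=
  semialgebraic_set
    [set (row_mx x (const_mx (f x)) : 'rV[R]_(n + 1)) | x in [set: 'rV[R]_n]].

Section Clarke.
Variables (R : realType) (n : nat) (ip : {dot 'rV[R]_n for idfun}).
Implicit Types (f : 'rV[R]_n -> R) (x h : 'rV[R]_n).

(* limsup, as y -> x and t -> 0 with t > 0, of (f (y + t h) - f y) / t. *)
Definition clarke_dd f x h : \bar R :=
  limf_esup (fun p : 'rV[R]_n * R => ((f (p.1 + p.2 *: h) - f p.1) / p.2)%:E)
            (filter_prod (nbhs x) (at_right (0 : R))).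

Definition clarke f x : set 'rV[R]_n :=
  [set s | forall h, ((ip s h)%:E <= clarke_dd f x h)%E].

Definition critical f : set 'rV[R]_n := [set x | clarke f x 0].

Definition subgradient_method f (alpha : R) (x : nat -> 'rV[R]_n) :=
  forall k, exists2 s, clarke f (x k) s & x k.+1 = x k - alpha *: s.

Definition leaves_ball f (alpha : R) (a : 'rV[R]_n) (e : R) x0 :=
  forall x : nat -> 'rV[R]_n, x 0%N = x0 -> subgradient_method f alpha x ->
    exists k, ~ ipball ip a e (x k).

Definition strongly_unstable f (a : 'rV[R]_n) :=
  exists2 e : R, 0 < e &
    finite_set [set alpha : R | 0 < alpha /\
      ~ lebesgue_null (ipball ip a e `&` [set x0 | ~ leaves_ball f alpha a e x0])].

End Clarke.

(* C^p on an open set U.  As V is finite-dimensional in all uses, f' is C^p as a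
   map into the space of linear maps iff it is so after evaluation at every v. *)
Fixpoint Cp_on (R : realType) (V W : normedModType R) (p : nat) (U : set V)
    (f : V -> W) : Prop :=
  if p is q.+1 then
    (forall x, U x -> differentiable f x) /\
    (forall v, Cp_on q U (fun x => 'd f x v))
  else forall x, U x -> {for x, continuous f}.

Section Manifold.
Variables (R : realType) (n : nat).
Implicit Types (S U T : set 'rV[R]_n) (x v : 'rV[R]_n).

Definition defining_map (p m : nat) S x U (phi : 'rV[R]_n -> 'rV[R]_(n - m)) :=
  [/\ open_nbhs x U, Cp_on p U phi,
      S `&` U = U `&` [set y | phi y = 0] &
      forall y, U y -> forall w, exists v, 'd phi y v = w].

Definition manifold_at (p m : nat) S x :=
  [/\ S x, (m <= n)%N & exists U phi, @defining_map p m S x U phi].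

(* The kernel of phi'(x), which does not depend on the C^1 defining map phi. *)
Definition tangent S x : set 'rV[R]_n :=
  [set v | exists m U phi,
     [/\ (m <= n)%N, @defining_map 1 m S x U phi & 'd phi x v = 0]].

Variable ip : {dot 'rV[R]_n for idfun}.

Definition C1_extension S (f : 'rV[R]_n -> R) x (g : 'rV[R]_n -> R) :=
  exists U, [/\ open_nbhs x U, Cp_on 1 U g & forall y, S y -> U y -> f y = g y].

Definition C1_on_manifold S f x := exists g, C1_extension S f x g.

(* The value does not depend on the C^1 extension g. *)
Definition riemannian_gradient S f x : 'rV[R]_n :=
  xget 0 [set proj ip (tangent S x) (gradient ip g x) | g in C1_extension S f x].

Definition verdier (f : 'rV[R]_n -> R) x S :=
  [/\ exists m, manifold_at 1 m S x, C1_on_manifold S f x &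
      exists U, exists2 c : R, nbhs x U /\ 0 < c &
        forall y z v, S y -> U y -> U z -> ~ S z -> clarke ip f z v ->
          ipnorm ip (proj ip (tangent S y) v - riemannian_gradient S f y)
            <= c * ipnorm ip (z - y)].

End Manifold.

Definition metrically_subregular (R : realType) (n m : nat)
    (ipn : {dot 'rV[R]_n for idfun}) (ipm : {dot 'rV[R]_m for idfun})
    (F : 'rV[R]_n -> set 'rV[R]_m) (x : 'rV[R]_n) (y : 'rV[R]_m) (theta : R) :=
  F x y /\ exists U, exists2 c : R, nbhs x U /\ 0 < c &
    forall z, U z ->
      (dist ipn z [set w | F w y] <= c%:E * (dist ipm y (F z)) `^ theta)%E.

(* Main.v *)
Require Import Defs.
From HB Require Import structures.
From mathcomp Require Import all_boot all_order all_algebra.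
From mathcomp Require Import sesquilinear separable.
From mathcomp Require Import all_classical all_reals all_analysis.
From mathcomp Require Import -(notations) mpoly.
From mathcomp Require Import lra ring.
Set Implicit Arguments.
Unset Strict Implicit.
Unset Printing Implicit Defensive.
Import Order.TTheory GRing.Theory Num.Theory.
Import numFieldNormedType.Exports.
Local Open Scope classical_set_scope.
Local Open Scope ring_scope.

(** Call an initial point bad if some run of the method starting there stays in a
    small ball around the point [xstar].  Such a run either reaches the critical set
    [S] at some iterate, or stays in the ball outside [S] for ever.

    The first case occurs for a null set of initial points only, for all but finitely
    many step sizes [alpha].  Near [xstar] the set [S] is null, as a manifold of
    positive codimension ([defining_map_null]), so it is enough that one step of the
    method pulls null sets back to null sets.  A semialgebraic function is a root of a
    nonzero polynomial [P] whose coefficients are polynomials in [x]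
    ([semialgebraic_fun_root]).  Hence, off the zeros of some nonzero polynomial, [f]
    is smooth with a gradient and a Hessian rational in [x] and [f x]
    ([algebraic_generically_smooth]); there its only Clarke subgradient is its gradient
    ([strict_diff_clarke]), and the step map is [x |-> x - alpha * grad f x].  Where its
    differential [1 - alpha * Hess f x] is invertible this map does not contract small
    distances by more than a constant factor, and such maps pull null sets back to null
    sets ([strict_diff_expansive], [lebesgue_null_expansive_preimage]).  The determinant
    of [1 - alpha * Hess f x], up to a denominator, is a polynomial in [alpha], [x] and
    [f x].  Eliminating [f x] between it and the square-free part of [P] by a resultant
    gives a polynomial in [alpha] and [x] which is nonzero for [alpha = 0]
    ([coprimep_det_resultant]).  So for all but finitely many [alpha] it is a nonzero
    polynomial in [x]; its zeros form a null set ([mpoly_zeros_null]), outside which the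
    differential is invertible.

    The second case never occurs.  Along such a run the values of [C] increase and are
    bounded, since [C] is bounded near [xstar].  If [theta1 = 0] they increase by a fixed
    amount at each step, which is absurd ([bounded_increments]).  Under the assumptions of
    the other alternative, the distance to [S] doubles at each step as long as it is
    smaller than some [eta] ([distance_doubling]); so it exceeds [eta] infinitely often,
    and infinitely often [C] increases by a fixed amount, which is absurd again.  The
    doubling holds because subgradients near [S] are long compared with the distance to
    [S], by subregularity of order greater than 1, and almost normal to [S], by the
    Verdier condition and because the Riemannian gradient of [f] vanishes along [S].  The
    latter fact, [riemannian_gradient_critical], is the delicate one, since 0 is only
    known to be a Clarke subgradient at the points of [S]. *)

(** * Null sets *)

Section Null.
Variables (R : realType) (n : nat).
Hypothesis n_gt0 : (0 < n)%N.
Implicit Types (A B : set 'rV[R]_n) (a b x y : 'rV[R]_n).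

Definition box a b := [set x : 'rV[R]_n | forall i, a 0 i <= x 0 i <= b 0 i].
Definition vol a b := \prod_(i < n) (b 0 i - a 0 i).

Lemma vol_ge0 a b : (forall i, a 0 i <= b 0 i) -> 0 <= vol a b.
Proof. by move=> ab; apply: prodr_ge0 => i _; rewrite subr_ge0. Qed.

Lemma vol_degenerate a : vol a a = 0.
Proof.
by rewrite /vol (bigD1 (Ordinal n_gt0)) //= subrr mul0r.
Qed.

Lemma lebesgue_null_double_cover A :
  (forall e : R, 0 < e -> exists a b : nat -> nat -> 'rV[R]_n,
    [/\ forall k l i, a k l 0 i <= b k l 0 i,
        A `<=` \bigcup_k \bigcup_l box (a k l) (b k l) &
        exists2 u : nat -> \bar R,
          forall k, (\sum_(l <oo) (vol (a k l) (b k l))%:E <= u k)%E &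
          (\sum_(k <oo) u k <= e%:E)%E]) ->
  lebesgue_null A.
Proof.
move=> H e e0; have [a [b [ab Acov [u vle ule]]]] := H e e0.
have [g] := (@pcard_eqP _ _ [set: nat] [set: nat * nat] (card_esym card_nat2)).
have gbij : set_bij [set: nat] [set: nat * nat] g.
  by split; [exact: funS|exact: inj|exact: surj].
exists (fun k => a (g k).1 (g k).2), (fun k => b (g k).1 (g k).2); split.
- by move=> k i.
- move=> x /Acov [k _ [l _ xkl]].
  have [_ _ /(_ (k, l) I) [j _ gj]] := gbij.
  by exists j => //; rewrite gj.
- rewrite nneseries_esumT; last by move=> k; rewrite lee_fin vol_ge0.
  rewrite -(reindex_esum _ _ _
     (fun p : nat * nat => (vol (a p.1 p.2) (b p.1 p.2))%:E) gbij).
  have -> : [set: nat * nat] = [set: nat] `*`` (fun=> [set: nat]).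
    by apply/seteqP; split.
  rewrite -(@esum_esum _ _ _ _ _ (fun k l => (vol (a k l) (b k l))%:E)); last first.
    by move=> k l _ _; rewrite lee_fin vol_ge0.
  apply: le_trans ule.
  have s0 k : (0 <= \sum_(l <oo) (vol (a k l) (b k l))%:E)%E.
    by apply: nneseries_ge0 => l _ _; rewrite lee_fin vol_ge0.
  rewrite nneseries_esumT; last by move=> k; exact: le_trans (s0 k) (vle k).
  apply: le_esum => k _; rewrite -nneseries_esumT //.
  by move=> l; rewrite lee_fin vol_ge0.
Qed.

Lemma lebesgue_null_subset A B : A `<=` B -> lebesgue_null B -> lebesgue_null A.
Proof.
move=> AB nB e /nB [a [b [ab Bab le]]]; exists a, b; split => //.
exact: subset_trans AB Bab.
Qed.

Lemma lebesgue_null_bigcup (A : nat -> set 'rV[R]_n) :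
  (forall k, lebesgue_null (A k)) -> lebesgue_null (\bigcup_k A k).
Proof.
move=> nA; apply: lebesgue_null_double_cover => e e0.
have H k : exists ab : (nat -> 'rV[R]_n) * (nat -> 'rV[R]_n),
    [/\ forall l i, ab.1 l 0 i <= ab.2 l 0 i,
        A k `<=` \bigcup_l box (ab.1 l) (ab.2 l) &
        (\sum_(l <oo) (vol (ab.1 l) (ab.2 l))%:E <= (e / (2 ^ k.+1)%:R)%:E)%E].
  have [|a [b ?]] := nA k (e / (2 ^ k.+1)%:R); first by rewrite divr_gt0.
  by exists (a, b).
have [ab Hab] := choice H.
exists (fun k => (ab k).1), (fun k => (ab k).2); split.
- by move=> k l i; have [/(_ l i)] := Hab k.
- move=> x [k _ Akx]; have [_ /(_ x Akx) [l _ xl] _] := Hab k.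
  by exists k => //; exists l.
- exists (fun k => (e / (2 ^ k.+1)%:R)%:E); last exact: epsilon_trick0 (ltW e0).
  by move=> k; have [] := Hab k.
Qed.

Lemma lebesgue_null0 : lebesgue_null (set0 : set 'rV[R]_n).
Proof.
move=> e e0; exists (fun=> 0), (fun=> 0); split => //.
by rewrite eseries0 ?lee_fin ?ltW// => k _ _; rewrite -/(vol 0 0) vol_degenerate.
Qed.

Lemma lebesgue_nullU A B : lebesgue_null A -> lebesgue_null B ->
  lebesgue_null (A `|` B).
Proof.
move=> nA nB.
apply: (@lebesgue_null_subset _ (\bigcup_k (if k is 0%N then A else B))).
  by move=> x [Ax|Bx]; [exists 0%N|exists 1%N].
by apply: lebesgue_null_bigcup => -[|k].
Qed.

Lemma lebesgue_null_bigcup_countable (I : countType) (A : I -> set 'rV[R]_n) :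
  (forall i, lebesgue_null (A i)) -> lebesgue_null (\bigcup_i A i).
Proof.
move=> nA.
apply: (@lebesgue_null_subset _
  (\bigcup_k (if unpickle k is Some i then A i else set0))).
  by move=> x [i _ Aix]; exists (pickle i); rewrite // pickleK.
by apply: lebesgue_null_bigcup => k; case: unpickle => //; exact: lebesgue_null0.
Qed.

(** Enlarging the sides by [d] pays for the cubes of the grid which stick out of
    the box. *)
Lemma box_cubes a b (d : R) : 0 < d -> (forall i, a 0 i <= b 0 i) ->
  exists N (c : nat -> 'rV[R]_n),
    box a b `<=` \bigcup_(l in `I_N) box (c l) (c l + const_mx d) /\
    N%:R * d ^+ n <= \prod_(i < n) (b 0 i - a 0 i + d).
Proof.
move=> d0 ab.
pose m (i : 'I_n) := (Num.truncn ((b 0 i - a 0 i) / d)).+1.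
have [M mM] : exists M, forall i, (m i <= M)%N.
  by exists (\max_(i < n) m i)%N => i; exact: leq_bigmax.
pose F := family (fun i : 'I_n => [pred j : 'I_M | (j < m i)%N]).
(* The cubes are indexed by the bounded multi-indices [F], listed as a sequence;
   beyond its end any point will do. *)
pose c (l : nat) : 'rV[R]_n :=
  if nth None (map Some (enum F)) l is Some j then
    \row_i (a 0 i + (j i : nat)%:R * d) else 0.
exists #|F|, c; split.
  move=> x xab.
  have tr (i : 'I_n) : (Num.truncn ((x 0 i - a 0 i) / d)%R < m i)%N.
    rewrite /m ltnS; apply: le_truncn.
    rewrite ler_pM2r ?invr_gt0//.
    by have /andP[_] := xab i; rewrite lerD2r.
  have trM (i : 'I_n) : (Num.truncn ((x 0 i - a 0 i) / d)%R < M)%N.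
    by apply: leq_trans (tr i) _; exact: mM.
  pose j : {ffun 'I_n -> 'I_M} := [ffun i => Ordinal (trM i)].
  have jF : j \in F by apply/familyP => i; rewrite ffunE inE /=.
  exists (index j (enum F)); first by rewrite /= cardE index_mem mem_enum.
  have -> : c (index j (enum F)) = \row_i (a 0 i + (j i : nat)%:R * d).
    by rewrite /c (nth_map j) ?index_mem ?mem_enum// nth_index ?mem_enum.
  move=> i; rewrite !mxE ffunE /=.
  have /andP[axi _] := xab i.
  have /(@truncn_itv R) /andP[t1 t2] : 0 <= (x 0 i - a 0 i) / d.
    by rewrite divr_ge0 ?subr_ge0 ?(ltW d0).
  set t := Num.truncn _ in t1 t2 *.
  move: t1 t2.
  rewrite ler_pdivlMr// ltr_pdivrMr// -[_.+1%:R]natr1 mulrDl mul1r => t1 t2.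
  by apply/andP; split; lra.
have -> : #|F| = (\prod_(i < n) m i)%N.
  rewrite card_family foldrE big_map big_enum /=; apply: eq_bigr => i _.
  rewrite -sum1_card (eq_bigl (fun k : 'I__ => (k < m i)%N)) //.
  by rewrite -(big_ord_widen _ (fun=> 1%N)) ?sum1_card ?card_ord//; exact: mM.
rewrite -[n in d ^+ n]card_ord -prodr_const natr_prod -big_split /=.
apply: ler_prod => i _; apply/andP; split; first by rewrite mulr_ge0 ?(ltW d0).
rewrite /m -natr1 [leLHS]mulrDl mul1r lerD2r -ler_pdivlMr//.
have /(@truncn_itv R) /andP[//] : 0 <= (b 0 i - a 0 i) / d.
by rewrite divr_ge0 ?subr_ge0 ?(ltW d0).
Qed.

Lemma prod_enlarge (l : 'I_n -> R) (e : R) : 0 < e ->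
  exists2 d : R, 0 < d & \prod_(i < n) (l i + d) <= \prod_(i < n) l i + e.
Proof.
move=> e0; pose p := \prod_(i < n) ((l i)%:P + 'X).
have pE d : p.[d] = \prod_(i < n) (l i + d).
  by rewrite horner_prod; apply: eq_bigr => i _; rewrite hornerD hornerC hornerX.
have : \forall d \near (0 : R)^'+, p.[d] < p.[0] + e.
  apply: (cvgr_lt p.[0]); last by rewrite ltrDl.
  by apply: cvg_at_right_filter; exact: continuous_horner.
move=> pd; near (0 : R)^'+ => d; exists d => //.
have p0 : p.[0] = \prod_(i < n) l i.
  by rewrite pE; apply: eq_bigr => i _; rewrite addr0.
by rewrite -pE -p0; apply: ltW; near: d; exact: pd.
Unshelve. all: by end_near. Qed.

(** A cube of side [d] pulls back into a cube of side [2 K d] centred at any point of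
    its preimage; so, once boxes are cut into cubes, the total volume of a cover
    grows at most by the factor [(2 K) ^+ n]. *)
Lemma lebesgue_null_expansive_preimage (g : 'rV[R]_n -> 'rV[R]_n) A B (K : R) :
  (forall x y, A x -> A y -> `|x - y| <= K * `|g x - g y|) ->
  lebesgue_null B -> lebesgue_null (A `&` g @^-1` B).
Proof.
move=> gK nB.
wlog K0 : K gK / 0 < K.
  move=> /(_ (`|K| + 1)); apply; last by rewrite ltr_wpDl.
  move=> x y Ax Ay; apply: le_trans (gK x y Ax Ay) _.
  by rewrite ler_wpM2r// (le_trans (ler_norm K))// lerDl.
apply: lebesgue_null_double_cover => e e0.
have C0 : 0 < (2 * K) ^+ n by rewrite exprn_gt0// mulr_gt0.
have e'0 : 0 < e / (2 * K) ^+ n / 2 by rewrite !divr_gt0.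
have [a [b [ab Bcov vle]]] := nB _ e'0.
pose e' := e / (2 * K) ^+ n / 2.
(* [d k] is so small that the cubes of side [d k] covering the k-th box have about
   the same total volume. *)
have H k : exists dNc : R * (nat * (nat -> 'rV[R]_n)),
  let d := dNc.1 in let N := dNc.2.1 in let c := dNc.2.2 in
  [/\ 0 < d,
    box (a k) (b k) `<=` \bigcup_(l in `I_N) box (c l) (c l + const_mx d) &
    N%:R * d ^+ n <= vol (a k) (b k) + e' / (2 ^ k.+1)%:R].
  have e'k : 0 < e' / (2 ^ k.+1)%:R by rewrite divr_gt0.
  have [d d0 dle] := prod_enlarge (fun i => b k 0 i - a k 0 i) e'k.
  have [N [c [cov Nle]]] := box_cubes d0 (ab k).
  by exists (d, (N, c)); split => //=; exact: le_trans Nle dle.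
have {H} [dNc HdNc] := choice H.
pose d k := (dNc k).1; pose N k := (dNc k).2.1; pose c k := (dNc k).2.2.
pose P k l := [set x | A x /\ box (c k l) (c k l + const_mx (d k)) (g x)].
pose p k l := xget 0 (P k l).
(* Beyond [N k] the cubes are degenerate. *)
pose r k l := if (l < N k)%N then K * d k else 0.
have r0 k l : 0 <= r k l.
  by rewrite /r; case: ifP => // _; rewrite mulr_ge0// ltW//; have [] := HdNc k.
exists (fun k l => p k l - const_mx (r k l)).
exists (fun k l => p k l + const_mx (r k l)).
split.
- by move=> k l i; rewrite !mxE; have := r0 k l; lra.
- move=> x [Ax Bgx]; have [k _ xk] := Bcov _ Bgx.
  have [d0 /(_ _ xk) [l lN xl] _] := HdNc k.
  exists k => //; exists l => //.
  have [Ap gp] : P k l (p k l) by apply: (@xgetPex _ 0 (P k l)); exists x.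
  have dist_g : `|g x - g (p k l)| <= d k.
    rewrite [leLHS]mx_normrE; apply: bigmax_le; first exact: ltW.
    move=> [i0 i] _ /=; rewrite !mxE ord1 ler_norml.
    have := xl i; have := gp i; rewrite !mxE -/(d k) => /andP[? ?] /andP[? ?].
    by apply/andP; split; lra.
  have := gK _ _ Ax Ap.
  rewrite [leLHS]mx_normrE => /bigmax_leP [_ nle] i.
  have := nle (0, i) isT; rewrite /= !mxE /r lN => xi.
  have : `|x 0 i - p k l 0 i| <= K * d k.
    by apply: le_trans xi _; rewrite ler_wpM2l// ltW.
  by rewrite ler_norml => /andP[? ?]; apply/andP; split; lra.
- exists (fun k => ((2 * K) ^+ n)%:E *
     ((vol (a k) (b k))%:E + (e' / (2 ^ k.+1)%:R)%:E))%E.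
    move=> k; have [d0 _ Nle] := HdNc k.
    have volE l : vol (p k l - const_mx (r k l)) (p k l + const_mx (r k l)) =
                  (2 * r k l) ^+ n.
      rewrite /vol -[n in RHS]card_ord -prodr_const; apply: eq_bigr => i _.
      by rewrite !mxE; ring.
    rewrite (nneseries_split 0 (N k)); last first.
      by move=> l _; rewrite lee_fin volE exprn_ge0// mulr_ge0.
    rewrite [X in (_ + X)%E]eseries0; last first.
      move=> l Nl _; rewrite volE /r ltnNge add0n in Nl *.
      by rewrite Nl mulr0 expr0n gtn_eqF.
    rewrite adde0 add0n sumEFin lee_fin big_mkord.
    under eq_bigr do rewrite volE /r ltn_ord.
    rewrite sumr_const card_ord mulrA exprMn -mulrnAr.
    by rewrite ler_wpM2l ?(ltW C0)// -[_ *+ N k]mulr_natl.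
  rewrite nneseriesZl; last first.
    move=> k _; rewrite -EFinD lee_fin addr_ge0//; first exact: vol_ge0.
    by rewrite divr_ge0// ltW.
  apply: (@le_trans _ _ (((2 * K) ^+ n)%:E * (e' + e')%:E)%E).
    rewrite lee_wpmul2l ?lee_fin ?(ltW C0)//.
    apply: le_trans (epsilon_trick _ _ (ltW e'0)) _.
      by move=> k; rewrite lee_fin vol_ge0.
    by rewrite EFinD leeD2r.
  by rewrite -EFinM lee_fin -splitr mulrC divfK// gt_eqF.
Qed.

End Null.

Section NullLocal.
Variables (R : realType) (n : nat).
Hypothesis n_gt0 : (0 < n)%N.
Implicit Types (A B : set 'rV[R]_n) (x y : 'rV[R]_n).

(** Countably many balls, with rational centres and radii [k.+1%:R^-1], form a
    base of the topology, so countably many of the given neighbourhoods suffice. *)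
Lemma lebesgue_null_local A :
  (forall x, A x -> exists2 V, nbhs x V & lebesgue_null (A `&` V)) ->
  lebesgue_null A.
Proof.
move=> locA.
pose Q := ({ffun 'I_n -> rat} * nat)%type.
pose D (q : Q) := [set y : 'rV[R]_n | `|\row_i ratr (q.1 i) - y| < q.2.+1%:R^-1].
pose A' (q : Q) := if `[< lebesgue_null (A `&` D q) >] then A `&` D q else set0.
apply: (@lebesgue_null_subset _ _ _ (\bigcup_q A' q)); last first.
  apply: lebesgue_null_bigcup_countable => // q; rewrite /A'.
  by case: asboolP => // _; exact: lebesgue_null0.
move=> x Ax; have [V /nbhs_ballP [e /= e0 xeV] nV] := locA x Ax.
have [k ke] : exists k, k.+1%:R^-1 < e / 2.
  exists (Num.truncn (e / 2)^-1); rewrite -[ltRHS]invrK.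
  rewrite ltf_pV2 ?posrE ?ltr0n ?invr_gt0 ?divr_gt0//.
  exact: truncnS_gt.
have k0 : 0 < k.+1%:R^-1 :> R by rewrite invr_gt0 ltr0n.
have /choice [c cx] : forall i : 'I_n, exists c : rat,
    x 0 i < ratr c < x 0 i + k.+1%:R^-1.
  move=> i; have xk : x 0 i < x 0 i + k.+1%:R^-1 by rewrite ltrDl.
  by have [c] := rat_in_itvoo xk; rewrite in_itv /=; exists c.
have Dx : D ([ffun i => c i], k) x.
  rewrite /D /= [ltLHS]mx_normrE; apply: bigmax_lt => // -[i0 i] _ /=.
  rewrite !mxE ffunE ord1; have /andP[c1 c2] := cx i.
  by rewrite ger0_norm ?subr_ge0 ?ltW// ltrBlDr addrC.
exists ([ffun i => c i], k) => //; rewrite /A' ifT//; apply/asboolP.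
apply: lebesgue_null_subset nV => y [Ay Dy]; split => //; apply: xeV.
rewrite -ball_normE /=.
apply: le_lt_trans (ler_distD (\row_i ratr ([ffun i => c i] i)) _ _) _.
rewrite [ltRHS]splitr ltrD//; first by rewrite distrC; apply: lt_trans ke.
exact: lt_trans ke.
Qed.

Lemma lebesgue_null_locally_expansive A B (g : 'rV[R]_n -> 'rV[R]_n) :
  (forall x, A x -> exists K : R, \forall p \near (x, x),
     `|p.1 - p.2| <= K * `|g p.1 - g p.2|) ->
  lebesgue_null B -> lebesgue_null (A `&` g @^-1` B).
Proof.
move=> gK nB; apply: lebesgue_null_local => x [Ax _].
have [K [[V1 V2] /= [V1x V2x] V12]] := gK x Ax.
exists (V1 `&` V2); first exact: filterI.
apply: lebesgue_null_subset (lebesgue_null_expansive_preimage n_gt0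
  (A := V1 `&` V2) (g := g) (K := K) _ nB).
  by move=> y [[_ By] Vy].
by move=> y z [V1y _] [_ V2z]; apply: (V12 (y, z)).
Qed.

Lemma lebesgue_null_hyperplane (i : 'I_n) :
  lebesgue_null [set x : 'rV[R]_n | x 0 i = 0].
Proof.
pose H (k : nat) := [set x : 'rV[R]_n | x 0 i = 0 /\ `|x| <= k%:R].
apply: (@lebesgue_null_subset _ _ _ (\bigcup_k H k)).
  move=> x xi0; exists (Num.truncn `|x|).+1 => //; split => //.
  by apply/ltW; exact: truncnS_gt.
apply: lebesgue_null_bigcup => // k e e0.
pose b : 'rV[R]_n := \row_j (if j == i then 0 else k%:R).
pose c (l : nat) : 'rV[R]_n := if l is 0%N return 'rV[R]_n then b else 0.
have c0 l j : 0 <= c l 0 j by case: l => [|l]; rewrite mxE //; case: ifP.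
exists (fun l => - c l), c; split.
- by move=> l j; rewrite mxE ge0_cp.
- move=> x [xi]; rewrite [leLHS]mx_normrE => /bigmax_leP [_ xk].
  exists 0%N => //= j; have := xk (0, j) isT; rewrite /= !mxE.
  case: eqP => [->|_]; first by rewrite xi oppr0 lexx.
  by rewrite ler_norml => /andP[-> ->].
- rewrite eseries0 ?lee_fin ?ltW// => l _ _; congr EFin.
  apply/eqP; rewrite prodf_seq_eq0; apply/hasP; exists i.
    by rewrite mem_index_enum.
  by case: l => [|l] /=; rewrite !mxE ?eqxx /= !oppr0 ?addr0 eqxx.
Qed.
End NullLocal.

(** * Strictly differentiable functions *)

Lemma near_cvg_to (T U : Type) (F : set_system T) (FF : Filter F) (f g : T -> U)
    (l : set_system U) :
  {near F, f =1 g} -> g @ F --> l -> f @ F --> l.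
Proof.
move=> fg gl; apply: cvg_trans gl; apply: near_eq_cvg.
by apply: filterS fg => x /esym.
Qed.

Lemma cvg_sumr (R : realType) (T : Type) (F : set_system T) (FF : Filter F)
    (I : finType) (u : I -> T -> R) (l : I -> R) :
  (forall i, u i t @[t --> F] --> l i) ->
  \sum_i u i t @[t --> F] --> \sum_i l i.
Proof.
move=> ul; apply: (@cvg_big R I +%R 0 xpredT) => //.
by move=> p; apply: cvgD; [exact: cvg_fst|exact: cvg_snd].
Qed.

Section Strict.
Variables (R : realType) (n N : nat).
Implicit Types (x : 'rV[R]_n) (u : 'rV[R]_n -> R) (phi : 'rV[R]_n -> 'rV[R]_N).

(** Carathéodory's form of strict differentiability: the increments of [u] are
    linear combinations of those of the coordinates of [phi], with coefficients
    which converge at the diagonal point.  For [phi] the identity this is strict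
    differentiability of [u] at [x] with partial derivatives [v].  For [phi] the
    map [y |-> (y, f y)] it allows one to differentiate polynomial expressions in
    [y] and [f y] before anything is known on the differentiability of [f]. *)
Definition strict_diff phi u x (v : 'I_N -> R) :=
  exists2 s : 'I_N -> 'rV[R]_n * 'rV[R]_n -> R,
    forall j, s j p @[p --> (x, x)] --> v j &
    \forall p \near (x, x),
      u p.2 - u p.1 = \sum_j (phi p.2 0 j - phi p.1 0 j) * s j p.

Lemma nbhs_pair1 x (P : set 'rV[R]_n) :
  nbhs x P -> \forall p \near (x, x), P p.1.
Proof.
move=> xP; exists (P, setT) => /=; last by move=> [y z] [].
by split=> //; exact: filterT.
Qed.

Lemma nbhs_pair2 x (P : set 'rV[R]_n) :
  nbhs x P -> \forall p \near (x, x), P p.2.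
Proof.
move=> xP; exists (setT, P) => /=; last by move=> [y z] [].
by split=> //; exact: filterT.
Qed.

Lemma strict_diff_ext phi u x v v' :
  v =1 v' -> strict_diff phi u x v -> strict_diff phi u x v'.
Proof. by move=> vv' [s sv us]; exists s => // j; rewrite -vv'. Qed.

Lemma strict_diff_cst phi c x : strict_diff phi (fun=> c) x (fun=> 0).
Proof.
exists (fun _ _ => 0) => [j|]; first exact: cvg_cst.
by near=> p; rewrite subrr big1// => j _; rewrite mulr0.
Unshelve. all: by end_near. Qed.

Lemma strict_diff_coord phi x k :
  strict_diff phi (fun y => phi y 0 k) x (fun j => (j == k)%:R).
Proof.
exists (fun j _ => (j == k)%:R) => [j|]; first exact: cvg_cst.
near=> p; rewrite (bigD1 k) //= eqxx mulr1 big1 ?addr0//.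
by move=> j /negPf ->; rewrite mulr0.
Unshelve. all: by end_near. Qed.

Lemma strict_diffD phi u w x v v' :
  strict_diff phi u x v -> strict_diff phi w x v' ->
  strict_diff phi (fun y => u y + w y) x (fun j => v j + v' j).
Proof.
move=> [s sv us] [t tv wt]; exists (fun j p => s j p + t j p) => [j|].
  exact: cvgD.
near=> p.
rewrite opprD addrACA (near us p)// (near wt p)// -big_split /=.
by apply: eq_bigr => j _; rewrite mulrDr.
Unshelve. all: by end_near. Qed.

Lemma strict_diffM phi u w x v v' :
  {for x, continuous u} -> {for x, continuous w} ->
  strict_diff phi u x v -> strict_diff phi w x v' ->
  strict_diff phi (fun y => u y * w y) x (fun j => v j * w x + u x * v' j).
Proof.
move=> cu cw [s sv us] [t tv wt].
exists (fun j p => s j p * w p.2 + u p.1 * t j p) => [j|].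
  apply: cvgD; apply: cvgM => //.
    apply: (@cvg_comp _ _ _ snd w); [exact: cvg_snd|exact: cw].
  by apply: (@cvg_comp _ _ _ fst u); [exact: cvg_fst|exact: cu].
near=> p.
transitivity ((u p.2 - u p.1) * w p.2 + u p.1 * (w p.2 - w p.1)); first by ring.
rewrite (near us p)// (near wt p)// mulr_suml mulr_sumr -big_split /=.
by apply: eq_bigr => j _; ring.
Unshelve. all: by end_near. Qed.

Lemma strict_diffN phi u x v : strict_diff phi u x v ->
  strict_diff phi (fun y => - u y) x (fun j => - v j).
Proof.
move=> [s sv us]; exists (fun j p => - s j p) => [j|]; first exact: cvgN.
near=> p; rewrite -opprD (near us p)// -sumrN.
by apply: eq_bigr => j _; rewrite mulrN.
Unshelve. all: by end_near. Qed.

Lemma strict_diffV phi u x v :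
  u x != 0 -> {for x, continuous u} -> strict_diff phi u x v ->
  strict_diff phi (fun y => (u y)^-1) x (fun j => - v j / (u x) ^+ 2).
Proof.
move=> ux cu [s sv us].
have c1 : u p.1 @[p --> (x, x)] --> u x.
  by apply: (@cvg_comp _ _ _ fst u); [exact: cvg_fst|exact: cu].
have c2 : u p.2 @[p --> (x, x)] --> u x.
  by apply: (@cvg_comp _ _ _ snd u); [exact: cvg_snd|exact: cu].
have n1 : \forall p \near (x, x), u p.1 != 0.
  by apply: (@nbhs_pair1 _ (fun y => u y != 0)); exact: (cvgr_neq0 _ cu ux).
have n2 : \forall p \near (x, x), u p.2 != 0.
  by apply: (@nbhs_pair2 _ (fun y => u y != 0)); exact: (cvgr_neq0 _ cu ux).
exists (fun j p => - s j p / (u p.1 * u p.2)) => [j|].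
  apply: cvgM; first exact: cvgN.
  by apply: cvgV; [rewrite mulf_neq0|rewrite expr2; exact: cvgM].
near=> p.
have p1 : u p.1 != 0 by near: p.
have p2 : u p.2 != 0 by near: p.
transitivity (- (u p.2 - u p.1) / (u p.1 * u p.2)); first by field; rewrite p1 p2.
rewrite (near us p)// -sumrN mulr_suml; apply: eq_bigr => j _.
by rewrite !mulrA mulrN.
Unshelve. all: by end_near. Qed.

Lemma strict_diff_continuous phi u x v :
  {for x, continuous phi} -> strict_diff phi u x v -> {for x, continuous u}.
Proof.
move=> cphi [s sv us].
have cvx : (x, y) @[y --> x] --> (x, x).
  exact: (@cvg_pair _ _ _ (nbhs x) (nbhs x) (nbhs x) _ _ _ (fun=> x) id
    (cvg_cst _) cvg_id).
rewrite /continuous_at.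
suff : u y - u x @[y --> x] --> 0.
  move=> /(cvgD (cvg_cst (u x))); rewrite addr0 => h.
  suff : (fun y => u x + (u y - u x)) @ x --> u x.
    by rewrite (_ : (fun y => _) = u)//; apply/funext => y; rewrite subrKC.
  exact: h.
have near_us : \forall y \near x, u y - u x =
    \sum_j (phi y 0 j - phi x 0 j) * s j (x, y).
  exact: (cvx _ us).
apply: near_cvg_to near_us _.
have E : \sum_(j < N) (0 * v j) = 0 by rewrite big1// => j _; rewrite mul0r.
suff : (fun y => \sum_j (phi y 0 j - phi x 0 j) * s j (x, y)) @ x -->
    \sum_(j < N) (0 * v j) by rewrite E.
apply: (cvg_sumr (nbhs_filter x)) => j.
apply: cvgM; last first.
  exact: (@cvg_comp _ _ _ (fun y => (x, y)) (s j) (nbhs x) _ _ cvx (sv j)).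
rewrite -(subrr (phi x 0 j)); apply: cvgB; last exact: cvg_cst.
apply: (@cvg_comp _ _ _ phi (fun z : 'rV[R]_N => z 0 j)); first exact: cphi.
exact: coord_continuous.
Qed.

End Strict.

Lemma mpoly_ring_ind (n : nat) (K : comNzRingType) (P : mpoly n K -> Prop) :
  (forall c, P (mpolyC n c)) ->
  (forall i : 'I_n, P (mpolyX K (mnm1 i))) ->
  (forall p q, P p -> P q -> P (p + q)) ->
  (forall p q, P p -> P q -> P (p * q)) -> forall p, P p.
Proof.
move=> PC PX PD PM; apply: mpolyind; first by have := PC 0; rewrite rmorph0.
move=> c m p _ _ Pp; apply: (PD) => //; rewrite -mul_mpolyC; apply: (PM) => //.
have P1 : P 1 by have := PC 1; rewrite rmorph1.
rewrite mpolyXE_id; apply: (big_ind P) => [//|p1 q1|i _]; first exact: PM.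
elim: (m i) => [//|k IH].
by rewrite exprS; apply: PM.
Qed.

Lemma coord_le_mx_norm (R : realType) (m n : nat) (M : 'M[R]_(m, n)) i j :
  `|M i j| <= `|M|.
Proof.
by rewrite [leRHS]mx_normrE; apply: (le_bigmax _ (fun p => `|M p.1 p.2|) (i, j)).
Qed.

Lemma mx_norm_le (R : realType) (m n : nat) (M : 'M[R]_(m, n)) (c : R) :
  0 <= c -> (forall i j, `|M i j| <= c) -> `|M| <= c.
Proof.
by move=> c0 Mc; rewrite [leLHS]mx_normrE; apply: bigmax_le => // -[i j] _.
Qed.

Section StrictCalculus.
Variables (R : realType) (n : nat).
Implicit Types (x : 'rV[R]_n) (u f : 'rV[R]_n -> R).

Lemma strict_diff_chain N M (psi : 'rV[R]_n -> 'rV[R]_M)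
    (phi : 'rV[R]_n -> 'rV[R]_N) u x v w :
  strict_diff psi u x v ->
  (forall j, strict_diff phi (fun y => psi y 0 j) x (w j)) ->
  strict_diff phi u x (fun k => \sum_j v j * w j k).
Proof.
move=> [s sv us] H.
have H' j : exists t : 'I_N -> 'rV[R]_n * 'rV[R]_n -> R,
    (forall k, t k p @[p --> (x, x)] --> w j k) /\
    \forall p \near (x, x),
      psi p.2 0 j - psi p.1 0 j = \sum_k (phi p.2 0 k - phi p.1 0 k) * t k p.
  by have [t ? ?] := H j; exists t.
have [t /all_and2 [tw psit]] := choice H'.
exists (fun k p => \sum_j s j p * t j k p).
  move=> k; apply: cvg_sumr => j; exact: cvgM.
near=> p.
rewrite (near us p)//.
transitivity (\sum_j \sum_k (phi p.2 0 k - phi p.1 0 k) * t j k p * s j p).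
  apply: eq_bigr => j _; rewrite -mulr_suml; congr (_ * _).
  by move: j; near: p; apply: filter_forall => j; exact: psit.
rewrite exchange_big; apply: eq_bigr => k _; rewrite mulr_sumr.
by apply: eq_bigr => j _; rewrite -mulrA (mulrC (t _ _ _)).
Unshelve. all: by end_near. Qed.

Lemma strict_diff_lincomb (I : finType) N (phi : 'rV[R]_n -> 'rV[R]_N)
    (w : 'rV[R]_n -> I -> R) (c : I -> R) x dw :
  (forall l, strict_diff phi (w ^~ l) x (fun k => dw k l)) ->
  strict_diff phi (fun y => \sum_l w y l * c l) x (fun k => \sum_l dw k l * c l).
Proof.
move=> H.
have H' l : exists t : 'I_N -> 'rV[R]_n * 'rV[R]_n -> R,
    (forall k, t k p @[p --> (x, x)] --> dw k l) /\
    \forall p \near (x, x),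
      w p.2 l - w p.1 l = \sum_k (phi p.2 0 k - phi p.1 0 k) * t k p.
  by have [t ? ?] := H l; exists t.
have [t /all_and2 [tw wt]] := choice H'.
exists (fun k p => \sum_l t l k p * c l).
  by move=> k; apply: cvg_sumr => l; apply: cvgM; [exact: tw|exact: cvg_cst].
near=> p.
rewrite -sumrB.
transitivity (\sum_l \sum_k (phi p.2 0 k - phi p.1 0 k) * (t l k p * c l)).
  apply: eq_bigr => l _; rewrite -mulrBl.
  under eq_bigr do rewrite mulrA.
  rewrite -mulr_suml; congr (_ * _).
  by move: l; near: p; apply: filter_forall => l; exact: wt.
by rewrite exchange_big; apply: eq_bigr => k _; rewrite mulr_sumr.
Unshelve. all: by end_near. Qed.

Definition graph_map f x : 'rV[R]_(n + 1) := row_mx x (const_mx (f x)).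

(** The implicit function theorem when the solution [f] is already given: its
    increments are obtained by solving the slope identity of [u], since the slope in
    the last direction does not vanish near the diagonal point. *)
Lemma strict_diff_implicit f u x v :
  strict_diff (graph_map f) u x v -> (\forall y \near x, u y = 0) ->
  v (rshift n 0) != 0 ->
  strict_diff id f x (fun j => - v (lshift 1 j) / v (rshift n 0)).
Proof.
move=> [s sv us] u0 v0.
exists (fun j p => - s (lshift 1 j) p / s (rshift n 0) p).
  by move=> j; apply: cvgM; [exact: cvgN|exact: cvgV].
have sn0 : \forall p \near (x, x), s (rshift n 0) p != 0.
  exact: (cvgr_neq0 _ (sv _) v0).
near=> p.
have sp0 : s (rshift n 0) p != 0 by near: p.
have : u p.2 - u p.1 = 0.
  have -> : u p.2 = 0 by near: p; exact: (nbhs_pair2 u0).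
  by have -> : u p.1 = 0 by [near: p; exact: (nbhs_pair1 u0)]; rewrite subrr.
rewrite (near us p)// big_split_ord /= big_ord1 /graph_map !row_mxEr !mxE.
under eq_bigr do rewrite !row_mxEl.
move=> h; apply: (mulIf sp0); rewrite mulr_suml.
rewrite -[LHS](addKr (\sum_j (p.2 0 j - p.1 0 j) * s (lshift 1 j) p)) h addr0.
rewrite -sumrN.
by apply: eq_bigr => j _; rewrite -mulrA divfK// mulrN.
Unshelve. all: by end_near. Qed.

Lemma strict_diff_lift f u x v : {for x, continuous f} ->
  strict_diff id u x v ->
  strict_diff (graph_map f) u x
    (fun k => if fintype.split k is inl j then v j else 0).
Proof.
move=> cf [s sv us].
exists (fun k p => if fintype.split k is inl j then s j p else 0).
  by move=> k; case: fintype.split => // _; exact: cvg_cst.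
near=> p; rewrite (near us p)// big_split_ord /= big_ord1 /graph_map.
rewrite (unsplitK (inr 0)) mulr0 addr0; apply: eq_bigr => j _.
by rewrite (unsplitK (inl j)) !row_mxEl.
Unshelve. all: by end_near. Qed.

Lemma graph_map_continuous f x : {for x, continuous f} ->
  {for x, continuous (graph_map f)}.
Proof.
move=> cf; apply/(@cvgrPdist_lt _ _ _ (nbhs x)) => e e0.
near=> y.
rewrite [ltLHS]mx_normrE; apply: bigmax_lt => // -[i0 k] _ /=.
rewrite ord1 !mxE; case: fintype.split => j /=.
  have -> : x 0 j - y 0 j = (x - y) 0 j by rewrite !mxE.
  have : `|x - y| < e by near: y; exact: (cvgr_dist_lt _ _ (cvg_id : id @ x --> x)).
  by apply: le_lt_trans; exact: coord_le_mx_norm.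
rewrite !mxE; near: y; exact: (cvgr_dist_lt _ _ cf).
Unshelve. all: by end_near. Qed.

(** * Polynomial functions of a point and of a value *)

Lemma strict_diff_mpoly (p : mpoly n R) x :
  strict_diff id (fun y => meval (y 0) p) x (fun j => meval (x 0) (mderiv j p)).
Proof.
have cid : {for x, continuous (id : 'rV[R]_n -> 'rV[R]_n)} by exact: cvg_id.
elim/mpoly_ring_ind: p => [c|i|p q sp sq|p q sp sq].
- apply: (strict_diff_ext (v := fun=> 0)) => [j|].
    by rewrite mderivC raddf0.
  have -> : (fun y : 'rV[R]_n => meval (y 0) (mpolyC n c)) = fun=> c.
    by apply/funext => y; rewrite mevalC.
  exact: strict_diff_cst.
- apply: (strict_diff_ext (v := fun j => (j == i)%:R)) => [j|].
    rewrite mderivX mevalZ mnm1E eq_sym.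
    case: eqP => [->|_]; last by rewrite mul0r.
    by rewrite mevalX mul1r big1// => k _; rewrite mnmBE subnn expr0.
  have -> : (fun y : 'rV[R]_n => meval (y 0) (mpolyX R (mnm1 i))) = fun y => y 0 i.
    by apply/funext => y; rewrite mevalXU.
  exact: strict_diff_coord.
- apply: (strict_diff_ext (v := fun j =>
    meval (x 0) (mderiv j p) + meval (x 0) (mderiv j q))) => [j|].
    by rewrite mderivD mevalD.
  have -> : (fun y : 'rV[R]_n => meval (y 0) (p + q)) =
      fun y => meval (y 0) p + meval (y 0) q.
    by apply/funext => y; rewrite mevalD.
  exact: strict_diffD.
- apply: (strict_diff_ext (v := fun j => meval (x 0) (mderiv j p) * meval (x 0) q +
    meval (x 0) p * meval (x 0) (mderiv j q))) => [j|].
    by rewrite mderivM mevalD !mevalM.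
  have -> : (fun y : 'rV[R]_n => meval (y 0) (p * q)) =
      fun y => meval (y 0) p * meval (y 0) q.
    by apply/funext => y; rewrite mevalM.
  exact: strict_diffM (strict_diff_continuous cid sp)
    (strict_diff_continuous cid sq) sp sq.
Qed.

(** Polynomials in [n + 1] variables are taken as polynomials in the last variable,
    whose coefficients are polynomials in the others: divisibility, derivatives and
    resultants are those with respect to the last variable. *)
Definition poly_eval x (y : R) : {poly (mpoly n R)} -> R :=
  horner_eval y \o map_poly (meval (x 0)).

HB.instance Definition _ x y := GRing.RMorphism.copy (poly_eval x y)
  (horner_eval y \o map_poly (meval (x 0))).

Lemma poly_evalC x y (c : mpoly n R) : poly_eval x y c%:P = meval (x 0) c.
Proof. by rewrite /poly_eval /= map_polyC /= /horner_eval hornerC. Qed.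

Lemma poly_evalX x y : poly_eval x y 'X = y.
Proof. by rewrite /poly_eval /= map_polyX /= /horner_eval hornerX. Qed.

(** The partial derivatives of [W] at the point [(x, f x)]. *)
Definition poly_grad f x (W : {poly (mpoly n R)}) (k : 'I_(n + 1)) : R :=
  match fintype.split k with
  | inl j => poly_eval x (f x) (map_poly (mderiv j) W)
  | inr _ => poly_eval x (f x) W^`()
  end.

Lemma strict_diff_poly_eval f x (W : {poly (mpoly n R)}) :
  {for x, continuous f} ->
  strict_diff (graph_map f) (fun y => poly_eval y (f y) W) x (poly_grad f x W).
Proof.
move=> cf; have cg := graph_map_continuous cf.
elim/poly_ind: W => [|W c IH].
  apply: (strict_diff_ext (v := fun=> 0)) => [k|].
    by rewrite /poly_grad; case: fintype.split => j; rewrite !raddf0.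
  have -> : (fun y => poly_eval y (f y) 0) = fun=> 0.
    by apply/funext => y; rewrite raddf0.
  exact: strict_diff_cst.
have -> : (fun y => poly_eval y (f y) (W * 'X + c%:P)) =
    fun y => poly_eval y (f y) W * f y + meval (y 0) c.
  by apply/funext => y; rewrite rmorphD rmorphM /= poly_evalX poly_evalC.
pose last_coord (k : 'I_(n + 1)) : R := (k == rshift n 0)%:R.
have sf : strict_diff (graph_map f) f x last_coord.
  have := strict_diff_coord (graph_map f) x (rshift n 0).
  congr (strict_diff _ _ _ _); apply/funext => y.
  by rewrite /graph_map row_mxEr mxE.
have := strict_diffD
  (strict_diffM (strict_diff_continuous cg IH) cf IH sf)
  (strict_diff_lift cf (strict_diff_mpoly c x)).
apply: strict_diff_ext => k; rewrite /poly_grad /last_coord -[k in k == _]splitK.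
have mdp j : map_poly (mderiv j) (W * 'X + c%:P) =
    map_poly (mderiv j) W * 'X + (mderiv j c)%:P.
  apply/polyP => l; rewrite coefD coefMX coefC !coef_map_id0 ?mderiv0//.
  by rewrite coefD coefMX coefC mderivD; case: (l == 0)%N; rewrite ?mderiv0.
case: fintype.split => j /=.
  rewrite eq_lrshift mulr0 addr0 mdp rmorphD rmorphM /=.
  by rewrite poly_evalX poly_evalC.
rewrite (ord1 j) eqxx mulr1 addr0 derivD derivM derivC derivX mulr1 addr0.
by rewrite rmorphD rmorphM /= poly_evalX addrC.
Qed.

(** * Maps which do not contract distances *)

Lemma mulmx_norm_le m (v : 'rV[R]_n) (M : 'M[R]_(n, m)) :
  `|v *m M| <= `|v| * (n%:R * `|M|).
Proof.
apply: mx_norm_le => [|i j]; first by rewrite !mulr_ge0.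
rewrite mxE; apply: le_trans (ler_norm_sum _ _ _) _.
apply: (@le_trans _ _ (\sum_(k < n) `|v| * `|M|)).
  apply: ler_sum => k _; rewrite normrM ler_pM//; exact: coord_le_mx_norm.
by rewrite sumr_const card_ord mulrCA mulr_natl.
Qed.

(** The injective half of the inverse function theorem.  The matrix [W] of slopes
    between two points near [x] is close to [J], so that
    [`|d| <= c * `|d *m W| + `|d| / 2] for their difference [d]. *)
Lemma strict_diff_expansive (g : 'rV[R]_n -> 'rV[R]_n) x (J : 'M[R]_n) :
  (forall j, strict_diff id (fun y => g y 0 j) x (J ^~ j)) -> J \in unitmx ->
  exists K : R, \forall p \near (x, x), `|p.1 - p.2| <= K * `|g p.1 - g p.2|.
Proof.
move=> gJ Ju.
have H j : exists s : 'I_n -> 'rV[R]_n * 'rV[R]_n -> R,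
    (forall i, s i p @[p --> (x, x)] --> J i j) /\
    \forall p \near (x, x),
      g p.2 0 j - g p.1 0 j = \sum_k (p.2 0 k - p.1 0 k) * s k p.
  by have [s ? ?] := gJ j; exists s.
have [s /all_and2 [sJ sg]] := choice H.
pose W p : 'M[R]_n := \matrix_(i, j) s j i p.
pose c := n%:R * `|invmx J|.
have c0 : 0 <= c by rewrite mulr_ge0.
pose eta := (2 * (n%:R * c + 1))^-1.
have eta0 : 0 < eta by rewrite invr_gt0 mulr_gt0// ltr_wpDl// mulr_ge0.
exists (2 * c); near=> p.
have WJ : `|J - W p| <= eta.
  apply: mx_norm_le (ltW eta0) _ => i j; rewrite !mxE.
  move: i j; near: p; apply: filter_forall => i; apply: filter_forall => j.
  by apply: filterS (cvgr_dist_lt _ _ (sJ j i) _ eta0) => p /ltW.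
have gW : (p.2 - p.1) *m W p = g p.2 - g p.1.
  apply/rowP => j; rewrite !mxE.
  have -> : g p.2 0 j - g p.1 0 j = \sum_k (p.2 0 k - p.1 0 k) * s j k p.
    by move: j; near: p; apply: filter_forall => j; exact: sg.
  by apply: eq_bigr => k _; rewrite !mxE.
set d := p.2 - p.1 in gW *.
rewrite distrC -/d [in leRHS]distrC -gW.
have dE : d = d *m W p *m invmx J + d *m (J - W p) *m invmx J.
  by rewrite -mulmxDl mulmxBr addrC subrK mulmxK.
have le1 : `|d *m W p *m invmx J| <= c * `|d *m W p|.
  by rewrite mulrC; exact: mulmx_norm_le.
have le2 : `|d *m (J - W p) *m invmx J| <= `|d| / 2.
  apply: le_trans (mulmx_norm_le _ _) _; rewrite -/c.
  apply: (@le_trans _ _ (`|d| * (n%:R * eta) * c)).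
    rewrite ler_wpM2r//; apply: le_trans (mulmx_norm_le _ _) _.
    by rewrite !ler_wpM2l.
  rewrite -mulrA ler_wpM2l// mulrAC /eta invfM mulrCA ger_pMr ?invr_gt0//.
  by rewrite ler_pdivrMr ?mul1r ?lerDl// ltr_wpDl// mulr_ge0.
have : `|d| <= c * `|d *m W p| + `|d| / 2.
  by rewrite {1}dE; apply: le_trans (ler_normD _ _) _; exact: lerD.
lra.
Unshelve. all: by end_near. Qed.

(** Taking [u] as a new i-th coordinate straightens the level sets of [u] into
    hyperplanes; this is how they are seen to be null. *)
Lemma strict_diff_replace_expansive u x v i :
  strict_diff id u x v -> v i != 0 ->
  let g := fun y : 'rV[R]_n => \row_j (if j == i then u y else y 0 j) in
  exists K : R, \forall p \near (x, x), `|p.1 - p.2| <= K * `|g p.1 - g p.2|.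
Proof.
move=> sv vi g.
pose J : 'M[R]_n := \matrix_(k, j) (if j == i then v k else (k == j)%:R).
apply: (@strict_diff_expansive g x J).
  move=> j; case: (eqVneq j i) => [->|ji].
    have -> : (fun y => g y 0 i) = u by apply/funext => y; rewrite mxE eqxx.
    by apply: strict_diff_ext sv => k; rewrite mxE eqxx.
  have -> : (fun y => g y 0 j) = (fun y : 'rV[R]_n => id y 0 j).
    by apply/funext => y; rewrite mxE (negPf ji).
  by apply: strict_diff_ext (strict_diff_coord id x j) => k; rewrite mxE (negPf ji).
rewrite -row_free_unit; apply: inj_row_free => w wJ.
have wj j : j != i -> w 0 j = 0.
  move=> ji; have /rowP /(_ j) := wJ.
  rewrite !mxE (bigD1 j)//= !mxE (negPf ji) eqxx mulr1.
  by rewrite big1 ?addr0// => k kj; rewrite !mxE (negPf ji) (negPf kj) mulr0.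
apply/rowP => j; rewrite [RHS]mxE; case: (eqVneq j i) => [->|/wj//].
have /rowP /(_ i) := wJ; rewrite !mxE (bigD1 i)//= !mxE eqxx.
rewrite big1 ?addr0 => [|k ki]; last by rewrite wj// mul0r.
by move/eqP; rewrite mulf_eq0 (negPf vi) orbF => /eqP.
Qed.

End StrictCalculus.

(** * Square-free parts and resultants *)

Lemma poly_roots_seq (A : idomainType) (p : {poly A}) : p != 0 ->
  exists s : seq A, forall a, root p a -> a \in s.
Proof.
have [k] := ubnP (size p); elim: k p => // k IH p; rewrite ltnS => pk p0.
have [[a ra]|nr] := EM (exists a, root p a); last first.
  by exists [::] => a ra; case: nr; exists a.
have [q pq] := factor_theorem p a ra.
have q0 : q != 0 by apply: contraNneq p0 => q0; rewrite pq q0 mul0r.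
have [|s qs] := IH q _ q0.
  by move: pk; rewrite pq size_Mmonic ?monicXsubC// size_XsubC addn2.
exists (a :: s) => b; rewrite pq rootM root_XsubC inE orbC => /orP[->//|/qs ->].
by rewrite orbT.
Qed.

(** The constants [c1] and [c2] clear denominators: [p] and its derivative are
    divided by their greatest common divisor over a mere integral domain. *)
Lemma squarefree_part (A : idomainType) (p : {poly A}) : p != 0 ->
  exists e d f : {poly A}, exists c1 c2 : A,
    [/\ c1 != 0 /\ c2 != 0, c1 *: p = e * d, c2 *: p^`() = f * d &
        coprimep e e^`()].
Proof.
move=> p0; pose d := gcdp p p^`().
have lc0 k : lead_coef d ^+ k != 0.
  by rewrite expf_neq0// lead_coef_eq0 gcdp_eq0 negb_and p0.
exists (p %/ d), d, (p^`() %/ d).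
exists (lead_coef d ^+ scalp p d), (lead_coef d ^+ scalp p^`() d).
split=> //; last by have := make_separable p0; rewrite separable_poly.unlock.
- rewrite Pdiv.Idomain.divp_eq (_ : p %% d = 0) ?addr0//.
  by apply/eqP; apply: (dvdp_gcdl p p^`()).
- rewrite Pdiv.Idomain.divp_eq (_ : p^`() %% d = 0) ?addr0//.
  by apply/eqP; apply: (dvdp_gcdr p p^`()).
Qed.

(** A root of [p] of multiplicity [m.+1] has multiplicity [m] in the derivative,
    hence at most [m] in the common divisor [d]. *)
Lemma root_squarefree_part (F : numFieldType) (p e d f : {poly F}) (c1 c2 : F) y :
  p != 0 -> c1 != 0 -> c2 != 0 -> c1 *: p = e * d -> c2 *: p^`() = f * d ->
  root p y -> root e y.
Proof.
move=> p0 c10 c20 pE dpE rp; apply/contraT => re.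
have [m [q nq pq]] := multiplicity_XsubC p y.
rewrite p0 /= in nq.
have m0 : (0 < m)%N.
  by case: m pq => // pq; move: nq; rewrite -[q]mulr1 -[1](expr0 ('X - y%:P)) -pq rp.
case: m m0 pq => // m _ pq.
have co : coprimep (('X - y%:P) ^+ m.+1) e.
  by apply: coprimep_expl; rewrite coprimep_sym coprimep_XsubC.
have dvd : ('X - y%:P) ^+ m.+1 %| d.
  rewrite -(Gauss_dvdpr _ co) -pE dvdpZr// pq.
  by rewrite dvdp_mull.
have : ('X - y%:P) ^+ m.+1 %| p^`().
  by rewrite -(dvdpZr _ _ c20) dpE dvdp_mull.
rewrite pq derivM deriv_exp derivXsubC mul1r /=.
rewrite dvdp_addr; last exact: dvdp_mull.
rewrite mulrnAr -mulrnAl exprS.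
rewrite dvdp_mul2r ?expf_neq0 ?polyXsubC_eq0// dvdp_XsubCl rootE hornerMn.
by rewrite mulrn_eq0 /= -rootE (negPf nq).
Qed.

(** The polynomial [r] is the resultant of [e] and of the determinant, seen as a
    function of [a]; that it lies in the ideal generated by both is the identity
    stated.  It is not zero, since for [a = 0] the determinant is a power of the
    derivative of [e] times a nonzero constant, hence prime to [e].
    The exponent 3 is the one of the denominator of the Hessian of an implicit
    function. *)
Lemma coprimep_det_resultant (A : idomainType) (n : nat) (e : {poly A})
    (M : 'M[A]_n) (Q : 'M[{poly A}]_n) :
  (1 < size e)%N -> coprimep e e^`() -> \det M != 0 ->
  exists2 r : {poly A}, r != 0 & forall a : A, exists u v : {poly A},
    (r.[a])%:P = u * e +
      v * \det (e^`() ^+ 3 *: map_mx polyC M - a%:P *: Q).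
Proof.
move=> se ce detM.
(* The outer variable is that of [e], the inner one stands for [a]. *)
pose e' : {poly {poly A}} := map_poly polyC e.
pose N : {poly {poly A}} := \det (map_poly polyC (e^`() ^+ 3) *:
   map_mx (map_poly polyC \o polyC) M -
   ('X%:P : {poly {poly A}}) *: map_mx (map_poly polyC) Q).
(* Adding a multiple of [e] makes the leading coefficient independent of [a], so
   that taking the resultant commutes with the evaluation at [a]. *)
pose N' := N + 'X^(size N) * e'.
have spec (a : A) : map_poly (horner_eval a) N =
    \det (e^`() ^+ 3 *: map_mx polyC M - a%:P *: Q).
  have mK (p : {poly A}) : map_poly (horner_eval a) (map_poly polyC p) = p.
    rewrite -map_poly_comp; apply: map_poly_id => c _ /=.
    by rewrite /horner_eval hornerC.
  rewrite /N -det_map_mx; congr (\det _); apply/matrixP => i j; rewrite !mxE.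
  rewrite rmorphB /= rmorphM [X in _ - X]rmorphM /= !mK.
  by rewrite [map_poly _ 'Y]map_polyC /= /horner_eval hornerX.
have spece (a : A) : map_poly (horner_eval a) e' = e.
  rewrite -map_poly_comp; apply: map_poly_id => c _ /=.
  by rewrite /horner_eval hornerC.
have c_e0 : lead_coef e != 0 by rewrite lead_coef_eq0 -size_poly_gt0 ltnW.
have sze' : size e' = size e by rewrite size_map_polyC.
have lc_e' : lead_coef e' = (lead_coef e)%:P.
  by rewrite lead_coef_map_inj //; exact: polyC_inj.
have e'0 : e' != 0 by rewrite -size_poly_gt0 sze' ltnW.
have szM : (size N < size ('X^(size N) * e')%R)%N.
  rewrite size_monicM ?monicXn// size_polyXn addSn /= sze'.
  by rewrite -[ltnLHS]addn0 ltn_add2l ltnW.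
have szN' : size N' = size ('X^(size N) * e') by rewrite /N' addrC size_polyDl.
have lc_N' : lead_coef N' = (lead_coef e)%:P.
  by rewrite /N' addrC lead_coefDl// lead_coef_monicM ?monicXn.
have sN' : (1 < size N')%N.
  rewrite szN' size_monicM ?monicXn// size_polyXn addSn /= sze'.
  by apply: leq_trans se _; rewrite leq_addl.
have specN' a : map_poly (horner_eval a) N' =
    \det (e^`() ^+ 3 *: map_mx polyC M - a%:P *: Q) + 'X^(size N) * e.
  by rewrite rmorphD rmorphM /= spec spece map_polyXn.
exists (resultant e' N').
  apply/eqP => /(congr1 (horner_eval 0)).
  rewrite map_resultant; last 2 first.
  - by rewrite lc_e' /= /horner_eval hornerC.
  - by rewrite lc_N' /= /horner_eval hornerC.
  rewrite /= spece specN' /horner_eval horner0 => /eqP.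
  have -> : \det (e^`() ^+ 3 *: map_mx polyC M - 0%:P *: Q) =
      (e^`() ^+ 3) ^+ n * (\det M)%:P.
    by rewrite polyC0 scale0r subr0 detZ -det_map_mx.
  rewrite resultant_eq0 addrC => ngcd.
  have : coprimep e ('X^(size N) * e + (e^`() ^+ 3) ^+ n * (\det M)%:P).
    rewrite coprimep_addl_mul coprimepMr !coprimep_expr//=.
    by rewrite -[(\det M)%:P]mulr1 mul_polyC coprimepZr// coprimep1.
  by rewrite /coprimep => /eqP cop; move: ngcd; rewrite cop.
move=> a.
have s1 : (1 < size e')%N by rewrite sze'.
have [[u v] _ /= /(congr1 (map_poly (horner_eval a)))] := resultant_in_ideal s1 sN'.
rewrite map_polyC rmorphD !rmorphM /= spece specN' => ->.
set D := \det _.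
exists (map_poly (horner_eval a) u + map_poly (horner_eval a) v * 'X^(size N)).
exists (map_poly (horner_eval a) v).
by rewrite mulrDr mulrDl mulrA [X in _ + X = _]addrC addrA.
Qed.

(** * Generic smoothness of algebraic functions *)

Lemma msize_mderiv_lt (n : nat) (K : idomainType) (q : mpoly n K) i :
  mderiv i q != 0 -> (msize (mderiv i q) < msize q)%N.
Proof.
move=> dq0; rewrite [msize (mderiv i q)]mmeasureE.
have q0 : (0 < msize q)%N.
  rewrite lt0n msize_poly_eq0; apply: contraNneq dq0 => ->; by rewrite mderiv0.
case: (msize q) q0 (@msize_mdeg_lt _ _ q) => // k _ qk.
rewrite ltnS; apply/bigmax_leqP_seq => m; rewrite mcoeff_msupp mcoeff_mderiv => qm _.
have /qk : mnm_add m (mnm1 i) \in msupp q.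
  by rewrite mcoeff_msupp; apply: contraNneq qm => ->; rewrite mul0rn.
by rewrite mdegD mdeg1 addn1.
Qed.

Lemma mderiv0_const (n : nat) (K : numDomainType) (q : mpoly n K) :
  (forall i, mderiv i q = 0) -> q = mpolyC n (mcoeff mnm0 q).
Proof.
move=> dq; apply/mpolyP => m; rewrite mcoeffC.
case: eqP => [<-|m0]; rewrite ?mulr1// mulr0.
have [i mi] : exists i, (0 < m i)%N.
  apply/existsP; apply: contra_notT m0 => /existsPn H.
  by apply/mnmP => i; rewrite mnm0E; apply/eqP; move: (H i); rewrite -eqn0Ngt.
have := mcoeff_mderiv i q (mnm_sub m (mnm1 i)).
rewrite dq mcoeff0.
have -> : mnm_add (mnm_sub m (mnm1 i)) (mnm1 i) = m.
  by apply: submK; apply/mnm_lepP => j; rewrite mnm1E; case: eqP => //= <-.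
by move=> /esym /eqP; rewrite mulrn_eq0 /= => /eqP.
Qed.

Section Generic.
Variables (R : realType) (n : nat).
Local Notation MP := (mpoly n R).
Implicit Types (x : 'rV[R]_n) (q : MP).

Lemma meval_continuous q : continuous (fun x : 'rV[R]_n => meval (x 0) q).
Proof. by move=> x; exact: (strict_diff_continuous cvg_id (strict_diff_mpoly q x)). Qed.

Lemma poly_evalZ x y (c : MP) W :
  poly_eval x y (c *: W) = meval (x 0) c * poly_eval x y W.
Proof. by rewrite -mul_polyC rmorphM /= poly_evalC. Qed.

Lemma poly_evalD x y (V W : {poly MP}) :
  poly_eval x y (V + W) = poly_eval x y V + poly_eval x y W.
Proof. exact: (rmorphD (poly_eval x y)). Qed.

Lemma poly_evalN x y (W : {poly MP}) : poly_eval x y (- W) = - poly_eval x y W.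
Proof. exact: (raddfN (poly_eval x y)). Qed.

Lemma poly_evalM x y (V W : {poly MP}) :
  poly_eval x y (V * W) = poly_eval x y V * poly_eval x y W.
Proof. exact: (rmorphM (poly_eval x y)). Qed.

Lemma poly_evalXn x y (W : {poly MP}) k :
  poly_eval x y (W ^+ k) = poly_eval x y W ^+ k.
Proof. exact: (rmorphXn (poly_eval x y)). Qed.

Lemma poly_eval_det x y (W : 'M[{poly MP}]_n) :
  poly_eval x y (\det W) = \det (map_mx (poly_eval x y) W).
Proof. by rewrite det_map_mx. Qed.

(** Induction on the degree: in characteristic zero a polynomial which is not
    constant has a nonzero partial derivative. *)
Lemma mpoly_ind_deriv (P : MP -> Prop) :
  (forall c, c != 0 -> P (mpolyC n c)) ->
  (forall q i, mderiv i q != 0 -> P (mderiv i q) -> P q) ->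
  forall q, q != 0 -> P q.
Proof.
move=> Pc Pd q; have [k] := ubnP (msize q); elim: k q => // k IH q.
rewrite ltnS => qk q0.
have [[i dq0]|nd] := pselect (exists i, mderiv i q != 0).
  by apply: (Pd _ i dq0); apply: IH => //; apply: leq_trans (msize_mderiv_lt dq0) qk.
have qC := mderiv0_const (q := q).
rewrite qC; last by move=> i; apply/eqP; apply: contra_notT nd => ?; exists i.
apply: Pc; apply: contraNneq q0 => q0; rewrite qC ?q0 ?rmorph0//.
by move=> i; apply/eqP; apply: contra_notT nd => ?; exists i.
Qed.

(** Zeros of [q] where some partial derivative does not vanish become points of a
    hyperplane once [q] replaces a coordinate; the other ones are zeros of that
    derivative. *)
Lemma mpoly_zeros_null q : (0 < n)%N -> q != 0 ->
  lebesgue_null [set x : 'rV[R]_n | meval (x 0) q = 0].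
Proof.
move=> n0; elim/mpoly_ind_deriv: q / => [c c0|q i dq0 IH].
  apply: lebesgue_null_subset (lebesgue_null0 n0) => x /=; rewrite mevalC => /eqP.
  by rewrite (negPf c0).
pose g := fun y : 'rV[R]_n => \row_j (if j == i then meval (y 0) q else y 0 j).
pose A := [set x : 'rV[R]_n | meval (x 0) (mderiv i q) != 0].
have nA : lebesgue_null (A `&` g @^-1` [set x : 'rV[R]_n | x 0 i = 0]).
  apply: lebesgue_null_locally_expansive => //; last exact: lebesgue_null_hyperplane.
  by move=> x dqx; exact: (strict_diff_replace_expansive (strict_diff_mpoly q x) dqx).
apply: lebesgue_null_subset (lebesgue_nullU nA IH) => x /= qx.
have [dqx|dqx] := eqVneq (meval (x 0) (mderiv i q)) 0; first by right.
by left; split => //=; rewrite mxE eqxx.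
Qed.

Lemma mpoly_nonzeros_dense q : q != 0 -> forall x (V : set 'rV[R]_n), nbhs x V ->
  exists2 y, V y & meval (y 0) q != 0.
Proof.
elim/mpoly_ind_deriv: q / => [c c0|q i dq0 IH] x V xV.
  by exists x; [exact: nbhs_singleton|rewrite mevalC].
have [y Vy dqy] : exists2 y, V° y & meval (y 0) (mderiv i q) != 0.
  by apply: IH (nbhs_interior xV).
have [qy|qy] := eqVneq (meval (y 0) q) 0; last first.
  by exists y => //; exact: interior_subset.
have [s sv us] := strict_diff_mpoly q y.
pose z (t : R) : 'rV[R]_n := y + t *: delta_mx 0 i.
have zc : z t @[t --> 0^'] --> y.
  apply: cvg_within_filter.
  suff : z @ 0 --> y + 0 *: delta_mx 0 i by rewrite scale0r addr0.
  by apply: cvgD; [exact: cvg_cst|exact: (cvgZ cvg_id (cvg_cst _))].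
have zy : (y, z t) @[t --> 0^'] --> (y, y).
  exact: (@cvg_pair _ _ _ _ (nbhs y) (nbhs y) _ _ _ (fun=> y) z (cvg_cst _) zc).
have sz : \forall t \near 0^', s i (y, z t) != 0.
  exact: (zy _ (cvgr_neq0 _ (sv i) dqy)).
have uz := zy _ us.
near (0 : R)^' => t.
have t0 : t != 0 by near: t; exact: nbhs_dnbhs_neq.
exists (z t).
  by near: t; exact: (zc _ Vy).
have -> : meval (z t 0) q = t * s i (y, z t).
  have /= : meval (z t 0) q - meval (y 0) q =
    \sum_j (z t 0 j - y 0 j) * s j (y, z t) by near: t; exact: uz.
  rewrite qy subr0 => ->; rewrite (bigD1 i)//= big1 ?addr0.
    by rewrite !mxE eqxx/= eqxx mulr1 addrAC subrr add0r.
  by move=> j ji; rewrite !mxE (negPf ji) andbF mulr0 addr0 subrr mul0r.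
rewrite mulf_neq0//; near: t; exact: sz.
Unshelve. all: by end_near. Qed.

(** Let [E] be the square-free part of [P] with respect to the last variable.  For
    generic [x], [f x] is a root of [E] but, by a Bezout relation, not of its
    derivative; implicit differentiation then gives the gradient [v] of [f], and
    differentiating once more its Hessian [H], a matrix of polynomials in [x] and
    [f x] divided by the cube of the derivative of [E].  If [\det (M - a *: H x)]
    vanished for all [x] in an open set, then [E] and the numerator of this
    determinant would have a common root there, and their resultant would be zero;
    as a function of [a] this resultant is a nonzero polynomial, with finitely many
    roots. *)
Lemma algebraic_generically_smooth (f : 'rV[R]_n -> R) (P : {poly MP}) :
  continuous f -> P != 0 -> (forall x, poly_eval x (f x) P = 0) ->
  exists (q : MP) (v : 'rV[R]_n -> 'I_n -> R) (H : 'rV[R]_n -> 'M[R]_n),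
  [/\ q != 0,
      forall x, meval (x 0) q != 0 -> strict_diff id f x (v x),
      forall x, meval (x 0) q != 0 ->
        forall j, strict_diff id (fun y => v y j) x (H x ^~ j) &
      forall M : 'M[R]_n, \det M != 0 -> exists s : seq R, forall a, a \notin s ->
        exists2 r : MP, r != 0 & forall x, meval (x 0) q != 0 ->
          meval (x 0) r != 0 -> \det (M - a *: H x) != 0].
Proof.
move=> cf P0 Pf.
have [E [D [F [c1 [c2 [[c10 c20] PE PF cop]]]]]] := squarefree_part P0.
have [u [[b1 b2] /= /andP[b10 b20] bez]] : exists u : {poly MP} * {poly MP},
    exists2 b : MP * MP, (b.1 != 0) && (b.2 != 0) &
      b.1 *: (u.1 * E + u.2 * E^`()) = b.2 *: 1.
  by have /Bezout_coprimepP [u /eqpP [b ? ?]] := cop; exists u; exists b.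
(* Where [q0] does not vanish, the specialization of [P] is nonzero and its roots are
   roots of the specialization of [E]. *)
pose q0 := c1 * c2 * lead_coef P.
have q00 : q0 != 0 by rewrite !mulf_neq0 ?lead_coef_eq0.
have Ef x : meval (x 0) q0 != 0 -> poly_eval x (f x) E = 0.
  rewrite /q0 !mevalM !mulf_eq0 !negb_or => /andP[/andP[xc1 xc2] xP].
  have mP (W : {poly MP}) c : map_poly (meval (x 0)) (c *: W) =
      meval (x 0) c *: map_poly (meval (x 0)) W.
    by rewrite map_polyZ.
  apply/eqP; rewrite -[_ == 0]/(root _ _).
  apply: (@root_squarefree_part _ (map_poly (meval (x 0)) P) _
    (map_poly (meval (x 0)) D) (map_poly (meval (x 0)) F)
    (meval (x 0) c1) (meval (x 0) c2)) => //.
  - apply: contraNneq xP => mP0.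
    by rewrite lead_coefE -[meval _ _](coef_map (meval (x 0))) mP0 coef0.
  - by rewrite -mP PE rmorphM.
  - by rewrite deriv_map -mP PF rmorphM.
  - by rewrite rootE; apply/eqP; exact: Pf.
have E'f x : meval (x 0) q0 != 0 -> meval (x 0) b2 != 0 ->
    poly_eval x (f x) E^`() != 0.
  move=> xq0 xb2; apply: contraNneq xb2 => E'0.
  have := congr1 (poly_eval x (f x)) bez.
  rewrite !poly_evalZ poly_evalD !poly_evalM Ef// E'0 !mulr0 addr0 mulr0.
  by rewrite rmorph1 mulr1 => <-.
have sE : (1 < size E)%N.
  rewrite ltnNge; apply/negP => /size1_polyC Ec.
  have c0 : E`_0 != 0.
    apply: contraNneq P0 => c0; have E0 : E = 0 by rewrite Ec c0 polyC0.
    move: PE; rewrite E0 mul0r -mul_polyC => /eqP.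
    by rewrite mulf_eq0 polyC_eq0 (negPf c10).
  have [x _] := mpoly_nonzeros_dense (mulf_neq0 q00 c0)
    (filterT : nbhs (0 : 'rV[R]_n) setT).
  rewrite mevalM mulf_eq0 negb_or => /andP[/Ef + /negP xc0].
  by rewrite Ec poly_evalC => /eqP.
pose q := q0 * b2.
have q_neq0 : q != 0 by rewrite mulf_neq0.
have qx x : meval (x 0) q != 0 -> meval (x 0) q0 != 0 /\ meval (x 0) b2 != 0.
  by rewrite mevalM mulf_eq0 negb_or => /andP.
have qnear x : meval (x 0) q != 0 -> nbhs x (fun y : 'rV[R]_n => meval (y 0) q != 0).
  by move=> xq; apply: (@cvgr_neq0 _ _ _ (nbhs x) _ _ _ (@meval_continuous q x) xq).
pose ev W x := poly_eval x (f x) W.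
pose dE j := map_poly (mderiv j) E.
pose v x j := - ev (dE j) x / ev E^`() x.
have sf x : meval (x 0) q != 0 -> strict_diff id f x (v x).
  move=> xq; have [xq0 xb2] := qx _ xq.
  have := strict_diff_implicit (strict_diff_poly_eval E (cf x)).
  rewrite /poly_grad (unsplitK (inr 0)) E'f// => sfx.
  apply: strict_diff_ext (sfx _ isT) => [j|]; first by rewrite (unsplitK (inl j)).
  by near=> y; apply: Ef; have [] // := qx y; near: y; exact: qnear.
pose A i j := map_poly (mderiv i) (dE j).
pose B i := map_poly (mderiv i) E^`().
(* The numerators of the second derivatives, by the quotient and chain rules
   applied to [v]. *)
pose Q0 i j := - A i j * E^`() ^+ 2 + dE j * B i * E^`() +
  (dE j)^`() * dE i * E^`() - dE j * E^`()^`() * dE i.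
pose Q := \matrix_(i, j) Q0 i j : 'M[{poly MP}]_n.
pose H x : 'M[R]_n := \matrix_(i, j) (ev (Q i j) x / ev E^`() x ^+ 3).
exists q, v, H; split => // [x xq j|M M0].
- have [xq0 xb2] := qx _ xq; have E'x := E'f _ xq0 xb2.
  have cg := graph_map_continuous (cf x).
  have sW W := strict_diff_poly_eval W (cf x).
  have cW W := strict_diff_continuous cg (sW W).
  have sV := strict_diffV E'x (cW E^`()) (sW E^`()).
  have svj := strict_diffM (strict_diff_continuous cg (strict_diffN (sW (dE j))))
    (strict_diff_continuous cg sV) (strict_diffN (sW (dE j))) sV.
  have sg k : strict_diff id (fun y => graph_map f y 0 k) x
      (fun i => if fintype.split k is inl l then (i == l)%:R else v x i).
    have := splitK k; case: (fintype.split k) => l <- /=.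
      have -> : (fun y => graph_map f y 0 (lshift 1 l)) = fun y : 'rV[R]_n => id y 0 l.
        by apply/funext => y; rewrite /graph_map row_mxEl.
      exact: strict_diff_coord.
    have -> : (fun y => graph_map f y 0 (rshift n l)) = f.
      by apply/funext => y; rewrite /graph_map row_mxEr mxE.
    exact: sf.
  have := strict_diff_chain svj sg; apply: strict_diff_ext => i.
  rewrite big_split_ord /= big_ord1 (unsplitK (inr 0)) (bigD1 i)//=.
  rewrite (unsplitK (inl i)) eqxx mulr1 big1 ?addr0; last first.
    by move=> l li; rewrite (unsplitK (inl l)) eq_sym (negPf li) mulr0.
  rewrite /poly_grad !(unsplitK (inr 0)) !(unsplitK (inl i)).
  rewrite !mxE /v -/(A i j) -/(B i) -!/(ev _ x).
  have -> : ev (Q0 i j) x =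
    - ev (A i j) x * ev E^`() x ^+ 2 + ev (dE j) x * ev (B i) x * ev E^`() x +
    ev (dE j)^`() x * ev (dE i) x * ev E^`() x -
    ev (dE j) x * ev E^`()^`() x * ev (dE i) x.
    by rewrite /ev !(poly_evalD, poly_evalN, poly_evalM, poly_evalXn).
  by field.
- have M'0 : \det (map_mx (mpolyC n (R := R)) M) != 0.
    by rewrite det_map_mx mpolyC_eq0.
  have [r r0 Hr] := coprimep_det_resultant Q sE cop M'0.
  have [s Hs] := poly_roots_seq r0.
  exists (map (mcoeff mnm0) s) => a as_; exists r.[mpolyC n a].
    apply: contra as_ => /Hs ra; apply/mapP; exists (mpolyC n a) => //.
    by rewrite mcoeffC eqxx mulr1.
  move=> x xq xr; have [xq0 xb2] := qx _ xq; have E'x := E'f _ xq0 xb2.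
  have [u1 [v1 /(congr1 (poly_eval x (f x)))]] := Hr (mpolyC n a).
  rewrite poly_evalC poly_evalD !poly_evalM Ef// mulr0 add0r => rE.
  move: xr; rewrite rE mulf_eq0 negb_or => /andP[_].
  rewrite poly_eval_det.
  have -> : map_mx (poly_eval x (f x))
      (E^`() ^+ 3 *: map_mx polyC (map_mx (mpolyC n (R:=R)) M) -
      (mpolyC n a)%:P *: Q) = ev E^`() x ^+ 3 *: (M - a *: H x).
    apply/matrixP => i j; rewrite !mxE.
    rewrite /ev /Q0.
    rewrite !(poly_evalD, poly_evalN, poly_evalM, poly_evalXn, poly_evalC) !mevalC.
    by field.
  by rewrite detZ mulf_eq0 negb_or => /andP[].
Unshelve. all: by end_near. Qed.
End Generic.

(** * Inner products and their norms *)

Section InnerProductTheory.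
Variables (R : realType) (n : nat) (ip : {dot 'rV[R]_n for idfun}).
Implicit Types (x y z v : 'rV[R]_n).
Local Notation N := (ipnorm ip).

Lemma ipC x y : ip x y = ip y x.
Proof. by rewrite hermC expr0 mul1r. Qed.

Lemma ipDl x y z : ip (x + y) z = ip x z + ip y z. Proof. exact: linearDl. Qed.
Lemma ipDr x y z : ip z (x + y) = ip z x + ip z y. Proof. exact: linearDr. Qed.
Lemma ipZl a x z : ip (a *: x) z = a * ip x z. Proof. exact: linearZl_LR. Qed.
Lemma ipZr a x z : ip z (a *: x) = a * ip z x. Proof. exact: linearZr_LR. Qed.
Lemma ipNl x z : ip (- x) z = - ip x z. Proof. exact: linearNl. Qed.
Lemma ipNr x z : ip z (- x) = - ip z x. Proof. exact: linearNr. Qed.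
Lemma ip0l z : ip 0 z = 0. Proof. exact: linear0l. Qed.
Lemma ip0r z : ip z 0 = 0. Proof. exact: linear0r. Qed.

Lemma ip_sumr (I : finType) (F : I -> 'rV[R]_n) z :
  ip z (\sum_i F i) = \sum_i ip z (F i).
Proof. by apply: (big_morph (ip z)) => [x y|]; [exact: ipDr|exact: ip0r]. Qed.

Lemma ip_suml (I : finType) (F : I -> 'rV[R]_n) z :
  ip (\sum_i F i) z = \sum_i ip (F i) z.
Proof. by rewrite ipC ip_sumr; apply: eq_bigr => i _; exact: ipC. Qed.

Lemma ip_gt0 x : x != 0 -> 0 < ip x x.
Proof. exact: neq0_dnorm_gt0. Qed.

Lemma ip_ge0 x : 0 <= ip x x.
Proof. by have [->|/ip_gt0/ltW//] := eqVneq x 0; rewrite ip0l. Qed.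

Lemma ipnorm_ge0 x : 0 <= N x. Proof. exact: sqrtr_ge0. Qed.

Lemma ipnorm_sqr x : N x ^+ 2 = ip x x.
Proof. by rewrite sqr_sqrtr ?ip_ge0. Qed.

Lemma ipnorm_eq0 x : (N x == 0) = (x == 0).
Proof.
rewrite sqrtr_eq0; apply/idP/eqP => [le0|->]; last by rewrite ip0l.
by apply/eqP; apply: contraTT le0 => /ip_gt0; rewrite -ltNge.
Qed.

Lemma ipnorm_gt0 x : (0 < N x) = (x != 0).
Proof. by rewrite lt_def ipnorm_eq0 ipnorm_ge0 andbT. Qed.

Lemma ipnormN x : (N (- x)) = N x.
Proof. by rewrite /ipnorm ipNl ipNr opprK. Qed.

Lemma ipnorm_sym x y : (N (x - y)) = (N (y - x)).
Proof. by rewrite -ipnormN opprB. Qed.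

Lemma ipnormZ a x : (N (a *: x)) = `|a| * N x.
Proof. by rewrite /ipnorm ipZl ipZr mulrA -expr2 sqrtrM ?sqr_ge0// sqrtr_sqr. Qed.

Lemma ip_cauchy_schwarz x y : ip x y <= N x * N y.
Proof.
have [->|y0] := eqVneq y 0; first by rewrite ip0r mulr_ge0 ?ipnorm_ge0.
have [->|x0] := eqVneq x 0; first by rewrite ip0l mulr_ge0 ?ipnorm_ge0.
have xp : 0 < N x by rewrite ipnorm_gt0.
have yp : 0 < N y by rewrite ipnorm_gt0.
have := ip_ge0 (N y *: x - N x *: y).
rewrite ipDl !ipDr !ipNl !ipNr !ipZl !ipZr -!ipnorm_sqr (ipC y x) => h.
have : 0 <= 2 * (N x * N y) * (N x * N y - ip x y) by lra.
by rewrite pmulr_rge0 ?subr_ge0// !mulr_gt0.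
Qed.

Lemma ip_cauchy_schwarz_norm x y : `|ip x y| <= N x * N y.
Proof.
rewrite ler_norml ip_cauchy_schwarz andbT lerNl -ipNl -(ipnormN x).
exact: ip_cauchy_schwarz.
Qed.

Lemma ipnormD x y : (N (x + y)) <= N x + N y.
Proof.
rewrite -(@ler_pXn2r _ 2) ?nnegrE ?addr_ge0 ?ipnorm_ge0//.
rewrite sqrrD !ipnorm_sqr ipDl !ipDr (ipC y x).
have := ip_cauchy_schwarz x y; lra.
Qed.

Lemma ipnormB x y : (N (x - y)) <= N x + N y.
Proof. by rewrite -(ipnormN y); exact: ipnormD. Qed.

Lemma ipnorm_distD z x y : (N (x - y)) <= (N (x - z)) + (N (z - y)).
Proof. by rewrite (_ : x - y = (x - z) + (z - y)) ?ipnormD// addrA subrK. Qed.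

Definition gram : 'M[R]_n := \matrix_(i, j) ip (delta_mx 0 i) (delta_mx 0 j).

Lemma ip_gram x y : ip x y = \sum_j (x *m gram) 0 j * y 0 j.
Proof.
rewrite {1}(row_sum_delta y) ip_sumr; apply: eq_bigr => j _.
rewrite ipZr mulrC; congr (_ * _); rewrite {1}(row_sum_delta x) ip_suml mxE.
by apply: eq_bigr => i _; rewrite ipZl mxE.
Qed.

Lemma gram_unit : gram \in unitmx.
Proof.
rewrite -row_free_unit; apply: inj_row_free => x xG; apply/eqP.
rewrite -ipnorm_eq0 -sqrf_eq0 ipnorm_sqr ip_gram xG big1// => j _.
by rewrite mxE mul0r.
Qed.

Lemma ipnorm_le_norm : exists2 c : R, 0 < c & forall x, N x <= c * `|x|.
Proof.
exists (1 + \sum_i (N (delta_mx 0 i))) => [|x].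
  by rewrite ltr_pwDl// sumr_ge0// => i _; exact: ipnorm_ge0.
rewrite {1}(row_sum_delta x).
apply: (@le_trans _ _ (\sum_i (N (x 0 i *: delta_mx 0 i)))).
  elim/big_ind2: _ => [|y a z b ya zb|//]; first by rewrite /ipnorm ip0l sqrtr0.
  by apply: le_trans (ipnormD _ _) _; exact: lerD.
rewrite mulrDl mul1r ler_wpDl// mulr_suml; apply: ler_sum => i _.
by rewrite ipnormZ mulrC ler_wpM2l ?ipnorm_ge0// coord_le_mx_norm.
Qed.

(** Each coordinate is the inner product with a vector of the dual basis, to which
    the Cauchy-Schwarz inequality applies. *)
Lemma norm_le_ipnorm : exists2 c : R, 0 < c & forall x, `|x| <= c * N x.
Proof.
pose G := invmx gram.
have coordE x i : x 0 i = ip x (delta_mx 0 i *m G^T).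
  rewrite ip_gram.
  have -> : \sum_j (x *m gram) 0 j * ((delta_mx 0 i : 'rV[R]_n) *m G^T) 0 j =
      (x *m gram *m G) 0 i.
    apply/esym; rewrite mxE; apply: eq_bigr => j _; congr (_ * _).
    by rewrite -rowE !mxE.
  by rewrite mulmxK// gram_unit.
exists (1 + \sum_i (N (delta_mx 0 i *m G^T))) => [|x].
  by rewrite ltr_pwDl// sumr_ge0// => i _; exact: ipnorm_ge0.
apply: mx_norm_le => [|i0 i].
  by rewrite mulr_ge0 ?ipnorm_ge0// addr_ge0// sumr_ge0// => i _; exact: ipnorm_ge0.
rewrite ord1 coordE; apply: le_trans (ip_cauchy_schwarz_norm _ _) _.
rewrite mulrC ler_wpM2r ?ipnorm_ge0// (bigD1 i)//= addrCA lerDl.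
by rewrite addr_ge0// sumr_ge0// => j _; exact: ipnorm_ge0.
Qed.

Lemma nbhs_ipball x (V : set 'rV[R]_n) : nbhs x V ->
  exists2 e : R, 0 < e & ipball ip x e `<=` V.
Proof.
move=> /nbhs_ballP [e /= e0 xeV]; have [c c0 cn] := norm_le_ipnorm.
exists (e / (2 * c)); first by rewrite divr_gt0// mulr_gt0.
move=> y xy; apply: xeV; rewrite -ball_normE /= distrC.
apply: le_lt_trans (cn _) _.
apply: (@le_lt_trans _ _ (c * (e / (2 * c)))); first by rewrite ler_wpM2l// ltW.
have -> : c * (e / (2 * c)) = e / 2 by field; rewrite gt_eqF.
by rewrite ltr_pdivrMr// ltr_pMr// ltr1n.
Qed.

Lemma ipball_nbhs x (e : R) : 0 < e -> nbhs x (ipball ip x e).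
Proof.
move=> e0; have [c c0 cn] := ipnorm_le_norm.
apply/nbhs_ballP; exists (e / c) => /=; first by rewrite divr_gt0.
move=> y; rewrite -ball_normE /= distrC => xy; rewrite /ipball /=.
by apply: le_trans (cn _) _; rewrite -ler_pdivlMl// mulrC ltW.
Qed.

End InnerProductTheory.

(** * Semialgebraic functions are algebraic *)

Section Semialgebraic.
Variables (R : realType) (n : nat).
Local Notation MP := (mpoly n R).
Local Notation pt x y := (row_mx x (const_mx y) : 'rV[R]_(n + 1)).
Implicit Types (x : 'rV[R]_n).

Definition last_var_gen (i : 'I_(n + 1)) : {poly MP} :=
  if fintype.split i is inl j then (mpolyX R (mnm1 j))%:P else 'X.

Definition last_var_poly : mpoly (n + 1) R -> {poly MP} :=
  mmap (polyC \o @mpolyC n R) last_var_gen.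

HB.instance Definition _ := GRing.RMorphism.copy last_var_poly
  (mmap (polyC \o @mpolyC n R) last_var_gen).

Lemma poly_eval_last_var x y p :
  poly_eval x y (last_var_poly p) = meval (pt x y 0) p.
Proof.
elim/mpoly_ring_ind: p => [c|i|p q hp hq|p q hp hq].
- by rewrite mevalC [last_var_poly _]mmapC /= poly_evalC mevalC.
- rewrite mevalXU [last_var_poly _]mmapX mmap1U /last_var_gen !mxE.
  case: fintype.split => j; first by rewrite poly_evalC mevalXU.
  by rewrite poly_evalX mxE.
- by rewrite [last_var_poly _]rmorphD [LHS]rmorphD mevalD -hp -hq.
- by rewrite [last_var_poly _]rmorphM [LHS]rmorphM mevalM -hp -hq.
Qed.

(** The product of all nonzero polynomials among the equations is a solution.  Over
    each [x] the point of the graph satisfies some clause; if the equations of this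
    clause all were zero, only the strict inequalities would remain, and the graph
    would contain other points over [x]. *)
Lemma semialgebraic_fun_root (f : 'rV[R]_n -> R) : semialgebraic_fun f ->
  exists2 P : {poly MP}, P != 0 & forall x, poly_eval x (f x) P = 0.
Proof.
move=> [D graphE].
pose inD x y := has (fun c => all (fun p => meval (pt x y 0) p == 0) c.1 &&
  all (fun q => 0 < meval (pt x y 0) q) c.2) D.
have graphP x y : inD x y <-> y = f x.
  have <- : [set pt x0 (f x0) | x0 in [set: 'rV[R]_n]] (pt x y) = inD x y.
    by rewrite graphE.
  split=> [[x0 _ /eq_row_mx [-> /matrixP /(_ 0 0)]]|->]; first by rewrite !mxE.
  by exists x.
exists (\prod_(c <- D) \prod_(p <- c.1 | last_var_poly p != 0) last_var_poly p).
  rewrite prodf_seq_neq0; apply/allP => c _ /=.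
  by rewrite prodf_seq_neq0; apply/allP => p _; exact/implyP.
move=> x; rewrite rmorph_prod; apply/eqP; rewrite prodf_seq_eq0.
have /hasP [c cD /andP[c1 c2]] := (graphP x (f x)).2 erefl.
apply/hasP; exists c => //=; rewrite rmorph_prod prodf_seq_eq0.
apply: contraT => /hasPn nex.
have c10 p : p \in c.1 -> last_var_poly p = 0.
  move=> pc; apply/eqP; apply: contraT => p0; have := nex p pc.
  by rewrite p0 /= poly_eval_last_var (eqP (allP c1 _ pc)) eqxx.
have near_c2 : \forall y \near f x, all (fun q => 0 < meval (pt x y 0) q) c.2.
  elim: c.2 c2 => [|q s IH] /=; first by move=> _; near=> y.
  move=> /andP[q0 /IH near_s]; near=> y.
  apply/andP; split; last by near: y.
  rewrite -poly_eval_last_var; near: y.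
  apply: (cvgr_gt (poly_eval x (f x) (last_var_poly q))).
    exact: continuous_horner.
  by rewrite poly_eval_last_var.
near (f x)^' => y.
have yf : y != f x by near: y; exact: nbhs_dnbhs_neq.
have : y = f x.
  apply/graphP; apply/hasP; exists c => //; apply/andP; split.
    by apply/allP => p /c10 p0; rewrite -poly_eval_last_var p0 rmorph0.
  near: y; exact: nbhs_dnbhs.
by move/eqP; rewrite (negPf yf).
Unshelve. all: by end_near. Qed.

End Semialgebraic.

(** * Clarke subgradients at points of strict differentiability *)

Section Clarke.
Variables (R : realType) (n : nat) (ip : {dot 'rV[R]_n for idfun}).
Implicit Types (f : 'rV[R]_n -> R) (x h s : 'rV[R]_n).

Lemma clarke_dd_le f x h (c : R) :
  (\forall p \near filter_prod (nbhs x) (0 : R)^'+,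
     f (p.1 + p.2 *: h) - f p.1 <= c * p.2) ->
  (clarke_dd f x h <= c%:E)%E.
Proof.
move=> [[V W] /= [xV W0] VW].
pose W' := W `&` [set t | 0 < t].
apply: (@le_trans _ _ (ereal_sup
    [set ((f (p.1 + p.2 *: h) - f p.1) / p.2)%:E | p in V `*` W'])).
  apply: ereal_inf_lbound; exists (V `*` W') => //; exists (V, W') => //; split => //=.
  by apply: filterI => //; exact: nbhs_right_gt.
apply: ge_ereal_sup => _ [[y t] [/= Vy [Wt t0]] <-].
by rewrite lee_fin ler_pdivrMr//; exact: (VW (y, t)).
Qed.

Lemma clarke_dd_ge f x h (c : R) :
  (\forall p \near filter_prod (nbhs x) (0 : R)^'+,
     c * p.2 <= f (p.1 + p.2 *: h) - f p.1) ->
  (c%:E <= clarke_dd f x h)%E.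
Proof.
move=> Hc.
apply: le_ereal_inf_tmp => _ [Z FZ <-].
have [p [Zp [Hp p2]]] : exists p : 'rV[R]_n * R,
    Z p /\ (c * p.2 <= f (p.1 + p.2 *: h) - f p.1 /\ 0 < p.2).
  have FF : ProperFilter (filter_prod (nbhs x) (at_right (0 : R))).
    exact: filter_prod_proper.
  apply: (@filter_ex _ _ FF); apply: filterI => //; apply: filterI => //.
  exists (setT, [set t | 0 < t]) => /=; last by move=> [y t] [].
  by split; [exact: filterT|exact: nbhs_right_gt].
apply: (@le_trans _ _ ((f (p.1 + p.2 *: h) - f p.1) / p.2)%:E).
  by rewrite lee_fin ler_pdivlMr.
by apply: ereal_sup_ubound; exists p.
Qed.

Lemma cvg_translate x h :
  (p.1, p.1 + p.2 *: h) @[p --> filter_prod (nbhs x) (at_right (0 : R))] --> (x, x).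
Proof.
have c1 : p.1 @[p --> filter_prod (nbhs x) (at_right (0 : R))] --> x by exact: cvg_fst.
have c2 : p.2 @[p --> filter_prod (nbhs x) (at_right (0 : R))] --> (0 : R).
  by apply: cvg_trans (cvg_snd) _; exact: cvg_within.
apply: (@cvg_pair _ _ _ _ (nbhs x) (nbhs x)) => //.
suff : (p.1 + p.2 *: h) @[p --> filter_prod (nbhs x) (at_right (0 : R))] --> x + 0 *: h.
  by rewrite scale0r addr0.
by apply: cvgD => //; exact: (cvgZ c2 (cvg_cst _)).
Qed.

Lemma strict_diff_clarke_dd f x v h : strict_diff id f x v ->
  clarke_dd f x h = (\sum_j h 0 j * v j)%:E.
Proof.
move=> [s sv fs]; set L := \sum_j _.
have quot : \forall p \near filter_prod (nbhs x) (0 : R)^'+,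
    f (p.1 + p.2 *: h) - f p.1 =
      (\sum_j h 0 j * s j (p.1, p.1 + p.2 *: h)) * p.2.
  have H0 : \forall p \near filter_prod (nbhs x) (0 : R)^'+,
      f (p.1 + p.2 *: h) - f p.1 =
      \sum_j ((p.1 + p.2 *: h) 0 j - p.1 0 j) * s j (p.1, p.1 + p.2 *: h).
    exact: (@cvg_translate x h _ fs).
  apply: filterS H0 => p ->; rewrite mulr_suml; apply: eq_bigr => j _.
  by rewrite !mxE; ring.
have lim : \sum_j h 0 j * s j (p.1, p.1 + p.2 *: h)
    @[p --> filter_prod (nbhs x) (at_right (0 : R))] --> L.
  apply: cvg_sumr => j; apply: cvgM; first exact: cvg_cst.
  exact: (cvg_comp _ _ (@cvg_translate x h) (sv j)).
have pos : \forall p \near filter_prod (nbhs x) (0 : R)^'+, 0 < p.2.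
  exists (setT, [set t | 0 < t]) => /=; last by move=> [y t] [].
  by split; [exact: filterT|exact: nbhs_right_gt].
apply/eqP; rewrite eq_le; apply/andP; split.
  apply/lee_addgt0Pr => e e0; rewrite -EFinD; apply: clarke_dd_le.
  have Le : L < L + e by rewrite ltrDl.
  apply: filterS3 pos quot (cvgr_lt _ lim _ Le) => p p20 -> /ltW le.
  by rewrite ler_pM2r.
apply/lee_subgt0Pr => e e0; rewrite -EFinB; apply: clarke_dd_ge.
have Le : L - e < L by rewrite ltrBlDr ltrDl.
apply: filterS3 pos quot (cvgr_gt _ lim _ Le) => p p20 -> /ltW le.
by rewrite ler_pM2r.
Qed.

(** The gradient for [ip] of a function with partial derivatives [v]. *)
Definition riesz (v : 'I_n -> R) : 'rV[R]_n := \row_j v j *m invmx (gram ip).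

Lemma ip_riesz v h : ip (riesz v) h = \sum_j h 0 j * v j.
Proof.
rewrite ip_gram /riesz mulmxKV ?gram_unit//; apply: eq_bigr => j _.
by rewrite mxE mulrC.
Qed.

(** The directional derivative is linear here, and a linear form dominated by
    another one is equal to it. *)
Lemma strict_diff_clarke f x v s : strict_diff id f x v ->
  clarke ip f x s <-> s = riesz v.
Proof.
move=> fv; split=> [sf|-> h]; last by rewrite (strict_diff_clarke_dd h fv) ip_riesz.
apply/eqP; rewrite -subr_eq0 -(ipnorm_eq0 ip) -sqrf_eq0 ipnorm_sqr.
rewrite eq_le ip_ge0 andbT ipDl ipNl ip_riesz subr_le0.
by have := sf (s - riesz v); rewrite (strict_diff_clarke_dd _ fv) lee_fin.
Qed.

(** At almost every point [f] is smooth, and there the differential of the step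
    map, [1 - alpha *: H x] up to the Gram matrix which converts partial derivatives
    into gradients, is invertible; so the step map is locally expansive. *)
Lemma null_subgradient_preimage f (q r : mpoly n R) (v : 'rV[R]_n -> 'I_n -> R)
    (H : 'rV[R]_n -> 'M[R]_n) (alpha : R) (A : set 'rV[R]_n) :
  (0 < n)%N -> q != 0 -> r != 0 ->
  (forall x, meval (x 0) q != 0 -> strict_diff id f x (v x)) ->
  (forall x, meval (x 0) q != 0 ->
     forall j, strict_diff id (fun y => v y j) x (H x ^~ j)) ->
  (forall x, meval (x 0) q != 0 -> meval (x 0) r != 0 ->
     \det (gram ip - alpha *: H x) != 0) ->
  lebesgue_null A ->
  lebesgue_null [set x | exists2 s, clarke ip f x s & A (x - alpha *: s)].
Proof.
move=> n0 q0 r0 fv vH detH nA.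
have nq := mpoly_zeros_null n0 q0; have nr := mpoly_zeros_null n0 r0.
pose G x := x - alpha *: riesz (v x).
pose Om := [set x : 'rV[R]_n | meval (x 0) q != 0 /\ meval (x 0) r != 0].
have nG : lebesgue_null (Om `&` G @^-1` A).
  apply: lebesgue_null_locally_expansive => // x [xq xr].
  pose J := (gram ip - alpha *: H x) *m invmx (gram ip).
  apply: (@strict_diff_expansive _ _ G x J); last first.
    rewrite unitmx_mul unitmx_inv gram_unit andbT unitmxE unitfE; exact: detH.
  move=> j; pose c l := - alpha * invmx (gram ip) l j.
  have -> : (fun y => G y 0 j) = fun y => id y 0 j + \sum_l v y l * c l.
    apply/funext => y; rewrite /G /riesz !mxE mulr_sumr -sumrN; congr (_ + _).
    by apply: eq_bigr => l _; rewrite mxE /c; ring.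
  apply: strict_diff_ext (strict_diffD (strict_diff_coord id x j)
    (strict_diff_lincomb c (vH x xq))) => i.
  rewrite /J mulmxBl mulmxV ?gram_unit// -scalemxAl !mxE; congr (_ + _).
  rewrite mulr_sumr -sumrN; apply: eq_bigr => l _; rewrite /c; ring.
apply: lebesgue_null_subset (lebesgue_nullU nG (lebesgue_nullU nq nr)) => x [s xs As].
have [xq|xq] := eqVneq (meval (x 0) q) 0; first by right; left.
have [xr|xr] := eqVneq (meval (x 0) r) 0; first by right; right.
left; split => //; rewrite /G /=.
by move/(strict_diff_clarke s (fv _ xq)) : xs => <-.
Qed.

End Clarke.

(** * Maps of class C1 *)

Section C1maps.
Variables (R : realType) (n k : nat).
Implicit Types (phi : 'rV[R]_n -> 'rV[R]_k) (x y z v w : 'rV[R]_n).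
Implicit Types (U : set 'rV[R]_n).

Lemma line_is_derive phi y w (s : R) (j : 'I_k) :
  differentiable phi (y + s *: w) ->
  is_derive s 1 (fun t : R => phi (y + t *: w) 0 j) ('d phi (y + s *: w) w 0 j).
Proof.
move=> dphi; set z := y + s *: w in dphi *.
have dv : h^-1 *: (phi (h *: w + z) - phi z) @[h --> 0^'] --> 'd phi z w.
  by rewrite -(deriveE _ dphi); exact: (diff_derivable (v := w) dphi).
pose g (t : R) := phi (y + t *: w) 0 j.
have dg : h^-1 *: (g (h *: 1 + s) - g s) @[h --> 0^'] --> 'd phi z w 0 j.
  rewrite (_ : (fun h => _) = (fun h => (h^-1 *: (phi (h *: w + z) - phi z)) 0 j)).
    exact: cvg_comp _ _ dv (@coord_continuous R 1 k 0 j ('d phi z w)).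
  apply/funext => h; rewrite /g !mxE /z; congr (_ * (phi _ _ _ - _)).
  by rewrite scalerDl -[h *: 1]/(h * 1) mulr1 addrCA.
by apply: DeriveDef; [apply/cvg_ex; exists ('d phi z w 0 j)|exact/cvg_lim].
Qed.

Lemma C1_of_C2 (U : set 'rV[R]_n) phi : Cp_on 2 U phi -> Cp_on 1 U phi.
Proof.
move=> [dphi c1]; split=> // v x Ux; apply: differentiable_continuous.
by have [+ _] := c1 v; apply.
Qed.

Lemma C1_diff_near U phi x v j (e : R) : Cp_on 1 U phi -> open_nbhs x U -> 0 < e ->
  \forall y \near x, `|'d phi y v 0 j - 'd phi x v 0 j| < e.
Proof.
move=> [_ /(_ v) cd] [oU Ux] e0.
have cj : (fun y => 'd phi y v 0 j) @ x --> 'd phi x v 0 j.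
  apply: (@cvg_comp _ _ _ (fun y => 'd phi y v) (fun z : 'rV[R]_k => z 0 j)).
    exact: cd.
  exact: coord_continuous.
near=> y; rewrite distrC; near: y.
exact: (cvgr_dist_lt _ _ cj).
Unshelve. all: by end_near. Qed.

(** The slopes are the partial derivatives at a point [z p] of the segment, given
    by the mean value theorem. *)
Lemma C1_strict_diff U phi x (j : 'I_k) : Cp_on 1 U phi -> open_nbhs x U ->
  strict_diff id (fun y => phi y 0 j) x (fun i => 'd phi x (delta_mx 0 i) 0 j).
Proof.
move=> c1 xU; have [oU Ux] := xU; have [dphi cd] := c1.
have /nbhs_ballP [e /= e0 xeU] := open_nbhs_nbhs xU.
pose T := ('rV[R]_n * 'rV[R]_n)%type.
have H (p : T) : exists z : 'rV[R]_n, ball x e p.1 -> ball x e p.2 ->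
    `|x - z| <= Num.max `|x - p.1| `|x - p.2| /\
    phi p.2 0 j - phi p.1 0 j = 'd phi z (p.2 - p.1) 0 j.
  have [p1|np1] := pselect (ball x e p.1); last by exists 0.
  have [p2|np2] := pselect (ball x e p.2); last by exists 0.
  pose a (t : R) := p.1 + t *: (p.2 - p.1).
  have xa (t : R) : 0 <= t <= 1 -> `|x - a t| <= Num.max `|x - p.1| `|x - p.2|.
    move=> /andP[t0 t1].
    have -> : x - a t = (1 - t) *: (x - p.1) + t *: (x - p.2).
      by rewrite /a !scalerBr !scalerBl !scale1r; apply/rowP => i; rewrite !mxE; ring.
    apply: le_trans (ler_normD _ _) _.
    rewrite !normrZ (ger0_norm t0) ger0_norm ?subr_ge0//.
    apply: (@le_trans _ _ ((1 - t) * Num.max `|x - p.1| `|x - p.2| +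
        t * Num.max `|x - p.1| `|x - p.2|)).
      by rewrite lerD// ler_wpM2l ?subr_ge0// le_max lexx ?orbT.
    by rewrite -mulrDl subrK mul1r.
  have da (t : R) : 0 <= t <= 1 -> differentiable phi (a t).
    move=> /xa t01; apply: dphi; apply: xeU; rewrite -ball_normE /=.
    apply: le_lt_trans t01 _; rewrite gt_max.
    by move: p1 p2; rewrite -!ball_normE /= => -> ->.
  have dl (t : R) : 0 <= t <= 1 -> is_derive t (1 : R) (fun t : R => phi (a t) 0 j)
      ('d phi (a t) (p.2 - p.1) 0 j).
    by move=> t01; apply: line_is_derive; exact: da.
  have [t|c|c] := @MVT R (fun t => phi (a t) 0 j)
    (fun t => 'd phi (a t) (p.2 - p.1) 0 j) 0 1 ltr01.
  - by rewrite in_itv /= => /andP[t0 t1]; apply: dl; rewrite !ltW.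
  - apply: continuous_in_subspaceT => t /set_mem /=; rewrite in_itv /= => t01.
    apply: differentiable_continuous; apply/derivable1_diffP.
    by case: (dl t t01).
  rewrite in_itv /= => /andP[t0 t1]; rewrite subr0 mulr1 /a scale1r scale0r addr0.
  rewrite subrKC => E; exists (a c) => _ _; split => //.
  by apply: xa; rewrite !ltW.
have [z Hz] := choice H.
have ballx : nbhs x (ball x e) by exact: nbhsx_ballx.
have b1 := nbhs_pair1 ballx; have b2 := nbhs_pair2 ballx.
exists (fun i p => 'd phi (z p) (delta_mx 0 i) 0 j); last first.
  apply: filterS2 b1 b2 => p p1 p2; have [_ ->] := Hz p p1 p2.
  rewrite {1}(row_sum_delta (p.2 - p.1)) linear_sum summxE.
  by apply: eq_bigr => i _; rewrite linearZ /= !mxE.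
have zx : z p @[p --> (x, x)] --> x.
  apply/cvgrPdist_lt => d d0.
  have xd : nbhs x (fun y => `|x - y| < d).
    exact: (cvgr_dist_lt _ _ (cvg_id : id @ x --> x) _ d0).
  apply: filterS2 (filterI b1 b2) (filterI (nbhs_pair1 xd) (nbhs_pair2 xd)).
  move=> p [p1 p2] [d1 d2]; have [le _] := Hz p p1 p2.
  by apply: le_lt_trans le _; rewrite gt_max; apply/andP.
move=> i; apply/cvgrPdist_lt => d d0; near=> p; rewrite distrC; near: p.
exact: (zx _ (C1_diff_near (delta_mx 0 i) j c1 xU d0)).
Unshelve. all: by end_near. Qed.

End C1maps.

Section C1bounds.
Variables (R : realType) (n k : nat).
Implicit Types (phi : 'rV[R]_n -> 'rV[R]_k) (x y z v w : 'rV[R]_n).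
Implicit Types (U : set 'rV[R]_n).

Lemma sum_coord_le w (c : 'I_n -> R) (e : R) :
  (forall i, `|c i| <= e) -> `|\sum_i w 0 i * c i| <= n%:R * e * `|w|.
Proof.
move=> ce; apply: le_trans (ler_norm_sum _ _ _) _.
apply: (@le_trans _ _ (\sum_(i < n) e * `|w|)).
  by apply: ler_sum => i _; rewrite normrM mulrC ler_pM// coord_le_mx_norm.
by rewrite sumr_const card_ord -mulrA mulr_natl.
Qed.

Lemma linear_coord_sum (D : {linear 'rV[R]_n -> 'rV[R]_k}) w j :
  D w 0 j = \sum_i w 0 i * D (delta_mx 0 i) 0 j.
Proof.
rewrite {1}(row_sum_delta w) linear_sum summxE.
by apply: eq_bigr => i _; rewrite linearZ /= !mxE.
Qed.

Lemma linear_dist_le (D1 D2 : {linear 'rV[R]_n -> 'rV[R]_k}) (d : R) : 0 <= d ->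
  (forall i j, `|D1 (delta_mx 0 i) 0 j - D2 (delta_mx 0 i) 0 j| <= d) ->
  forall w, `|D1 w - D2 w| <= n%:R * d * `|w|.
Proof.
move=> d0 H w; apply: mx_norm_le => [|i0 j]; first by rewrite !mulr_ge0.
rewrite ord1 !mxE !linear_coord_sum -sumrB; under eq_bigr do rewrite -mulrBr.
exact: sum_coord_le.
Qed.

Lemma C1_strict_bound U phi x (e : R) : Cp_on 1 U phi -> open_nbhs x U -> 0 < e ->
  \forall p \near (x, x),
    `|phi p.2 - phi p.1 - 'd phi x (p.2 - p.1)| <= e * `|p.2 - p.1|.
Proof.
move=> c1 xU e0.
pose d := e / (n%:R + 1).
have d0 : 0 < d by rewrite divr_gt0// ltr_wpDl.
have H (j : 'I_k) : \forall p \near (x, x),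
    `|phi p.2 0 j - phi p.1 0 j - 'd phi x (p.2 - p.1) 0 j| <= e * `|p.2 - p.1|.
  have [s sv us] := C1_strict_diff j c1 xU.
  near=> p.
  rewrite (near us p)// linear_coord_sum.
  have -> : \sum_i (id p.2 0 i - id p.1 0 i) * s i p -
      \sum_i (p.2 - p.1) 0 i * 'd phi x (delta_mx 0 i) 0 j =
      \sum_i (p.2 - p.1) 0 i * (s i p - 'd phi x (delta_mx 0 i) 0 j).
    by rewrite -sumrB; apply: eq_bigr => i _; rewrite !mxE mulrBr.
  apply: (@le_trans _ _ (n%:R * d * `|p.2 - p.1|)).
    apply: sum_coord_le => // i; move: i; near: p; apply: filter_forall => i.
    near=> p; rewrite distrC ltW//; near: p.
    exact: (cvgr_dist_lt _ _ (sv i) _ d0).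
  rewrite ler_wpM2r// /d mulrCA ger_pMr// ler_pdivrMr ?ltr_wpDl// mul1r lerDl.
  exact: ler01.
near=> p; apply: mx_norm_le => [|i j]; first by rewrite mulr_ge0// ltW.
rewrite ord1 !mxE; move: j; near: p; apply: filter_forall => j; near=> p.
have := near (H j) p; apply => //.
Unshelve. all: by end_near. Qed.

Lemma C1_diff_bound U phi x (e : R) : Cp_on 1 U phi -> open_nbhs x U -> 0 < e ->
  \forall y \near x, forall w, `|'d phi y w - 'd phi x w| <= e * `|w|.
Proof.
move=> c1 xU e0.
pose d := e / (n%:R + 1).
have d0 : 0 < d by rewrite divr_gt0// ltr_wpDl.
near=> y => w.
apply: (@le_trans _ _ (n%:R * d * `|w|)).
  apply: linear_dist_le (ltW d0) _ w => i j; apply: ltW; move: j i; near: y.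
  apply: filter_forall => j; apply: filter_forall => i.
  exact: C1_diff_near c1 xU d0.
rewrite ler_wpM2r// /d mulrCA ger_pMr// ler_pdivrMr ?ltr_wpDl// mul1r lerDl.
exact: ler01.
Unshelve. all: by end_near. Qed.

Lemma diff_right_inverse phi x :
  (forall w : 'rV[R]_k, exists v, 'd phi x v = w) ->
  exists B : 'M[R]_(k, n), forall w : 'rV[R]_k, 'd phi x (w *m B) = w.
Proof.
move=> surj; have [b Hb] := choice (fun i : 'I_k => surj (delta_mx 0 i)).
exists (\matrix_i b i) => w; rewrite mulmx_sum_row linear_sum [RHS]row_sum_delta.
by apply: eq_bigr => i _; rewrite linearZ /= rowK Hb.
Qed.

(** The norm of row vectors bundled with their completeness, for the Banach fixed
    point theorem. *)
Definition complete_rV (m : nat) : completeNormedModType R :=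
  HB.pack_for (completeNormedModType R) 'rV[R]_m (Complete.on 'rV[R]_m).

(** Lyusternik's theorem: the vectors of the kernel are tangent to the zero set.
    The correction [u] is sought as [w *m B] with [B] a right inverse of the
    differential, and [w] is a fixed point of [w |-> w - phi (x + s *: v + w *m B)],
    which is Newton's iteration with a constant slope. *)
Lemma kernel_tangent_points U phi x v (e : R) :
  Cp_on 1 U phi -> open_nbhs x U ->
  (forall w : 'rV[R]_k, exists v, 'd phi x v = w) ->
  phi x = 0 -> 'd phi x v = 0 -> 0 < e ->
  exists s u, [/\ 0 < s, s < e, `|u| <= e * s & phi (x + s *: v + u) = 0].
Proof.
move=> c1 xU surj phix0 dv0 e0.
have [B HB] := diff_right_inverse surj.
pose b := k%:R * `|B| + 1.
have b0 : 0 < b by rewrite ltr_wpDl// mulr_ge0.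
have Bb (w : 'rV[R]_k) : `|w *m B| <= b * `|w|.
  apply: le_trans (mulmx_norm_le _ _) _.
  by rewrite mulrC ler_wpM2r// lerDl.
have v0 : 0 < `|v| + 1 by rewrite ltr_wpDl.
(* [c] bounds the relative error of the linear approximation of [phi]: the first
   term makes the iteration a contraction of ratio 1/2, the second one makes [u]
   small compared with [s]. *)
pose c := Num.min (2 * b)^-1 (e / (2 * b * (`|v| + 1))).
have c0 : 0 < c.
  by rewrite lt_min; apply/andP; split; rewrite ?invr_gt0 ?divr_gt0// !mulr_gt0.
have cb : c * b <= 2^-1.
  apply: (@le_trans _ _ ((2 * b)^-1 * b)).
    by rewrite ler_wpM2r ?(ltW b0)// ge_min lexx.
  by rewrite invfM -mulrA mulVf ?mulr1// gt_eqF.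
have ce : 2 * c * `|v| * b <= e.
  apply: (@le_trans _ _ (2 * (e / (2 * b * (`|v| + 1))) * (`|v| + 1) * b)).
    rewrite ler_wpM2r ?(ltW b0)// ler_pM ?mulr_ge0 ?(ltW c0)// ?lerDl//.
    by rewrite ler_wpM2l// ge_min lexx orbT.
  by rewrite le_eqVlt; apply/orP; left; apply/eqP; field; rewrite !gt_eqF.
have [d d0 strict] : exists2 d : R, 0 < d & forall y z, `|x - y| < d -> `|x - z| < d ->
    `|phi z - phi y - 'd phi x (z - y)| <= c * `|z - y|.
  have [[V1 V2] /= [V1x V2x] V12] := C1_strict_bound c1 xU c0.
  have xV : nbhs x (V1 `&` V2) by exact: filterI.
  have [d /= d0 dV] := (nbhs_ballP _ _).1 xV.
  have bV y : `|x - y| < d -> (V1 `&` V2) y.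
    by move=> xy; apply: dV; rewrite -ball_normE.
  by exists d => // y z /bV [V1y _] /bV [_ V2z]; apply: (V12 (y, z)).
pose s := Num.min (e / 2) (d / (4 * (`|v| + 1))).
have s0 : 0 < s.
  by rewrite lt_min; apply/andP; split; rewrite divr_gt0// mulr_gt0.
have se : s < e by rewrite gt_min ltr_pdivrMr// ltr_pMr// ltr1n.
have svd : s * `|v| < d / 2.
  apply: (@le_lt_trans _ _ (d / (4 * (`|v| + 1)) * (`|v| + 1))).
    by rewrite ler_pM ?(ltW s0) ?lerDl// ge_min lexx orbT.
  have -> : d / (4 * (`|v| + 1)) * (`|v| + 1) = d / 4 by field; rewrite gt_eqF.
  lra.
pose r := 2 * c * (s * `|v|).
have r0 : 0 <= r by rewrite !mulr_ge0 ?(ltW c0) ?(ltW s0).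
have br : b * r <= s * `|v|.
  have sv0 : 0 <= s * `|v| by rewrite mulr_ge0// ltW.
  rewrite /r; have -> : b * (2 * c * (s * `|v|)) = (2 * (c * b)) * (s * `|v|) by ring.
  by apply: ler_piMl => //; lra.
pose z (w : 'rV[R]_k) := x + s *: v + w *m B.
have xz (w : 'rV[R]_k) : `|w| <= r -> `|x - z w| < d.
  move=> wr; have -> : x - z w = - (s *: v + w *m B).
    by rewrite /z; apply/rowP => i; rewrite !mxE; ring.
  rewrite normrN.
  apply: le_lt_trans (ler_normD _ _) _; rewrite normrZ (gtr0_norm s0).
  have : `|w *m B| <= s * `|v|.
    by apply: le_trans (Bb w) _; apply: le_trans br; rewrite ler_wpM2l// ltW.
  lra.
pose X := complete_rV k.
pose g : X -> X := fun t : 'rV[R]_k => t - phi (z t).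
pose Ball : set X := [set t : X | `|t| <= r].
have gdist (w1 w2 : 'rV[R]_k) : `|w1| <= r -> `|w2| <= r ->
    `|g w1 - g w2| <= 2^-1 * `|w1 - w2|.
  move=> w1r w2r.
  have zB : z w1 - z w2 = (w1 - w2) *m B.
    by rewrite /z opprD addrACA subrr add0r mulmxBl.
  have := strict _ _ (xz _ w2r) (xz _ w1r); rewrite zB HB => le.
  have -> : g w1 - g w2 = - (phi (z w1) - phi (z w2) - (w1 - w2)).
    by rewrite /g; apply/rowP => i; rewrite !mxE; ring.
  rewrite normrN; apply: le_trans le _.
  apply: (@le_trans _ _ (c * (b * `|w1 - w2|))); first by rewrite ler_wpM2l ?(ltW c0).
  by rewrite mulrA ler_wpM2r.
have g0 : `|g 0| <= c * (s * `|v|).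
  have z0 : z 0 = x + s *: v by rewrite /z mul0mx addr0.
  have xx : `|x - x| < d by rewrite subrr normr0.
  have xz0 : `|x - z 0| < d by apply: xz; rewrite normr0.
  have := strict _ _ xx xz0; rewrite z0 phix0 subr0 addrAC subrr add0r.
  rewrite linearZ /= dv0 scaler0 subr0 normrZ (gtr0_norm s0).
  by rewrite /g sub0r normrN z0.
have gBall : set_fun Ball Ball g.
  move=> w wr; rewrite /Ball /=.
  have := gdist w 0 wr; rewrite normr0 subr0 => /(_ r0) le.
  have -> : g w = (g w - g 0) + g 0 by rewrite subrK.
  apply: le_trans (ler_normD _ _) _.
  have wr' : `|w| <= r := wr.
  have : r = 2 * (c * (s * `|v|)) by rewrite /r; ring.
  lra.
pose gf : {fun Ball >-> Ball} := mkfun gBall.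
have gc : is_contraction gf.
  exists (2^-1)%:nng; split => /=; first by rewrite invf_lt1// ltr1n.
  move=> [w1 w2] [/= w1r w2r]; exact: gdist.
have clB : closed Ball.
  by apply: (@preimage_closed _ _ (fun t : X => `|t|) [set t | t <= r]) => [w _|];
    [exact: norm_continuous|exact: closed_le].
have [|w wr wE] := banach_fixed_point gc clB.
  by exists 0; rewrite /Ball /= normr0.
exists s, (w *m B); split => //.
  have wr' : `|w| <= r := wr.
  apply: le_trans (Bb w) _.
  apply: (@le_trans _ _ (b * r)); first by rewrite ler_wpM2l// ltW.
  rewrite /r; have -> : b * (2 * c * (s * `|v|)) = (2 * c * `|v| * b) * s by ring.
  by rewrite ler_wpM2r// ltW.
move: wE => /= /eqP; rewrite /g -subr_eq0 opprB addrCA subrr addr0 => /eqP.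
exact.
Qed.

End C1bounds.

(** * Tangent spaces and orthogonal projections *)

Section Tangent.
Variables (R : realType) (n : nat).
Implicit Types (S U : set 'rV[R]_n) (x y z v w : 'rV[R]_n).

Lemma defining_map_zero p m S x U (phi : 'rV[R]_n -> 'rV[R]_(n - m)) y :
  defining_map p S x U phi -> U y -> S y <-> phi y = 0.
Proof.
move=> [_ _ SU _] Uy; split=> [Sy|phiy].
  by have : (S `&` U) y by []; rewrite SU => -[].
by have : (U `&` [set y | phi y = 0]) y by []; rewrite -SU => -[].
Qed.

Lemma linear_norm_le k (D : {linear 'rV[R]_n -> 'rV[R]_k}) w :
  `|D w| <= n%:R * `|lin1_mx D| * `|w|.
Proof. by rewrite -mul_rV_lin1 mulrC; exact: mulmx_norm_le. Qed.

(** Two defining maps have the same kernel at [y]: a vector of one kernel is a limit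
    of directions of chords from [y] to points of [S], at which the other map
    vanishes too. *)
Lemma tangentE m S x U (phi : 'rV[R]_n -> 'rV[R]_(n - m)) y :
  (m <= n)%N -> defining_map 1 S x U phi -> S y -> U y ->
  tangent S y = [set v | 'd phi y v = 0].
Proof.
move=> mn dphi Sy Uy; have [[oU _] c1 SU surj] := dphi.
have yU : open_nbhs y U by [].
apply/seteqP; split => [v|v dv0]; last first.
  by exists m, U, phi; split => //; split => // w /surj.
move=> [m' [U' [phi' [_ dphi' dv0]]]].
have [yU' c1' _ surj'] := dphi'.
have phi'y : phi' y = 0 by apply/(defining_map_zero dphi' yU'.2).
have phiy : phi y = 0 by apply/(defining_map_zero dphi Uy).
apply/eqP; rewrite -normr_eq0; apply/negP => /negP.
set D := 'd phi y; rewrite -normr_gt0 normr_id => Dv0.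
pose K := n%:R * `|lin1_mx D| + 1.
have K0 : 0 < K by rewrite ltr_wpDl// mulr_ge0.
have DK w : `|D w| <= K * `|w|.
  by apply: le_trans (linear_norm_le D w) _; rewrite ler_wpM2r// lerDl.
have v0 : 0 < `|v| + 1 by rewrite ltr_wpDl.
have eta0 : 0 < `|D v| / (4 * (`|v| + 1)) by rewrite divr_gt0// mulr_gt0.
have [d d0 Hd] : exists2 d : R, 0 < d & forall z, `|y - z| < d ->
    [/\ U z, U' z & `|phi z - phi y - D (z - y)| <=
      `|D v| / (4 * (`|v| + 1)) * `|z - y|].
  have [[V1 V2] /= [V1x V2x] V12] := C1_strict_bound c1 yU eta0.
  have yV : nbhs y (V2 `&` (U `&` U')).
    by apply: filterI => //; apply: filterI; exact: open_nbhs_nbhs.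
  have [d /= d0 dV] := (nbhs_ballP _ _).1 yV.
  exists d => // z yz; have [|V2z [Uz U'z]] := dV z; first by rewrite -ball_normE.
  by split => //; apply: (V12 (y, z)); split => //=; exact: nbhs_singleton.
pose e := Num.min 1 (Num.min (d / (2 * (`|v| + 1))) (`|D v| / (4 * K))).
have e0 : 0 < e by rewrite !lt_min ltr01 !divr_gt0// mulr_gt0.
have e1 : e <= 1 by rewrite ge_min lexx.
have ed : e * (`|v| + 1) < d.
  apply: (@le_lt_trans _ _ (d / (2 * (`|v| + 1)) * (`|v| + 1))).
    by rewrite ler_wpM2r ?(ltW v0)// !ge_min lexx orbT.
  have -> : d / (2 * (`|v| + 1)) * (`|v| + 1) = d / 2 by field; rewrite gt_eqF.
  lra.
have eK : K * e <= `|D v| / 4.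
  apply: (@le_trans _ _ (K * (`|D v| / (4 * K)))).
    by rewrite ler_wpM2l ?(ltW K0)// !ge_min lexx !orbT.
  by rewrite le_eqVlt; apply/orP; left; apply/eqP; field; rewrite gt_eqF.
have [s [u [s0 se ue phi'z]]] :=
  kernel_tangent_points c1' yU' (surj' y yU'.2) phi'y dv0 e0.
pose z := y + s *: v + u.
have zy : z - y = s *: v + u by rewrite /z; apply/rowP => i; rewrite !mxE; ring.
have nzy : `|z - y| <= s * (`|v| + 1).
  rewrite zy; apply: le_trans (ler_normD _ _) _.
  rewrite normrZ (gtr0_norm s0) mulrDr mulr1 lerD2l; apply: le_trans ue _.
  by rewrite ler_piMl// ltW.
have [|Uz U'z strict] := Hd z.
  rewrite distrC; apply: le_lt_trans nzy _; apply: le_lt_trans ed.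
  by rewrite ler_wpM2r ?ltW.
have phiz : phi z = 0.
  by apply/(defining_map_zero dphi Uz)/(defining_map_zero dphi' U'z).
move: strict.
rewrite phiz phiy subrr sub0r normrN zy linearD linearZ /= -zy => strict.
(* As [phi] vanishes at [y] and [z], the norm of [D (z - y)] is at most
   [s * (`|D v| / 4)]; but [z - y] differs from [s *: v] by [u] only. *)
have h1 : `|s *: D v| <= `|s *: D v + D u| + `|D u|.
  by rewrite -{1}(addrK (D u) (s *: D v)); exact: ler_normB.
have h2 := DK u.
have h3 : `|s *: D v + D u| <= s * (`|D v| / 4).
  apply: le_trans strict _.
  apply: (@le_trans _ _ (`|D v| / (4 * (`|v| + 1)) * (s * (`|v| + 1)))).
    by rewrite ler_wpM2l ?(ltW eta0).
  by rewrite le_eqVlt; apply/orP; left; apply/eqP; field; rewrite gt_eqF.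
have h4 : K * `|u| <= s * (`|D v| / 4).
  apply: (@le_trans _ _ (K * (e * s))); first by rewrite ler_wpM2l ?(ltW K0).
  by rewrite mulrA mulrC ler_wpM2l ?(ltW s0).
move: h1; rewrite normrZ (gtr0_norm s0) => h1.
have : 0 < s * `|D v| by rewrite mulr_gt0.
lra.
Qed.

(** The defining map leaves 0 along a direction which its differential does not
    kill; there is one because the codimension is positive. *)
Lemma defining_map_complement_dense m S x U (phi : 'rV[R]_n -> 'rV[R]_(n - m)) y
    (V : set 'rV[R]_n) : (m < n)%N -> defining_map 1 S x U phi ->
  S y -> U y -> nbhs y V -> exists2 z, V z & ~ S z.
Proof.
move=> mn dphi Sy Uy yV; have [[oU _] c1 _ surj] := dphi.
have yU : open_nbhs y U by [].
have phiy : phi y = 0 by apply/(defining_map_zero dphi Uy).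
have [u Du] := surj _ Uy (const_mx 1).
have nm0 : (0 < n - m)%N by rewrite subn_gt0.
have Du0 : 0 < `|'d phi y u|.
  rewrite normr_gt0 Du; apply/eqP => /matrixP /(_ 0 (Ordinal nm0)).
  by rewrite !mxE => /eqP; rewrite oner_eq0.
have u0 : 0 < `|u| + 1 by rewrite ltr_wpDl.
have eta0 : 0 < `|'d phi y u| / (2 * (`|u| + 1)) by rewrite divr_gt0// mulr_gt0.
have [[V1 V2] /= [V1x V2x] V12] := C1_strict_bound c1 yU eta0.
have yW : nbhs y (V2 `&` (V `&` U)).
  by apply: filterI => //; apply: filterI => //; exact: open_nbhs_nbhs.
have [d /= d0 dV] := (nbhs_ballP _ _).1 yW.
pose t := d / (2 * (`|u| + 1)).
have t0 : 0 < t by rewrite divr_gt0// mulr_gt0.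
pose z := y + t *: u.
have zy : z - y = t *: u by rewrite /z addrAC subrr add0r.
have [|V2z [Vz Uz]] := dV z.
  rewrite -ball_normE /= distrC zy normrZ (gtr0_norm t0).
  apply: (@le_lt_trans _ _ (t * (`|u| + 1))); first by rewrite ler_wpM2l ?lerDl// ltW.
  have -> : t * (`|u| + 1) = d / 2 by rewrite /t; field; rewrite gt_eqF.
  lra.
exists z => // Sz.
have phiz : phi z = 0 by apply/(defining_map_zero dphi Uz).
have := V12 (y, z) (conj (nbhs_singleton V1x) V2z).
rewrite /= phiz phiy zy subrr sub0r normrN.
have -> : 'd phi y (t *: u) = t *: 'd phi y u by exact: linearZ.
rewrite (normrZ t u) normrZ (gtr0_norm t0) mulrCA ler_pM2l// => h.
have : `|'d phi y u| <= `|'d phi y u| / 2.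
  apply: le_trans h _.
  apply: (@le_trans _ _ (`|'d phi y u| / (2 * (`|u| + 1)) * (`|u| + 1))).
    by rewrite ler_wpM2l ?lerDl// ltW.
  by rewrite le_eqVlt; apply/orP; left; apply/eqP; field; rewrite gt_eqF.
lra.
Qed.

End Tangent.

Section Projection.
Variables (R : realType) (n k : nat) (ip : {dot 'rV[R]_n for idfun}).
Implicit Types (v p q : 'rV[R]_n) (D : {linear 'rV[R]_n -> 'rV[R]_k}).

(** The normal equations in a basis [K] of the kernel: [K *m G *m K^T] is the Gram
    matrix of this basis, invertible because the inner product is definite. *)
Lemma kernel_orthogonal_split D v : exists2 p, D p = 0 &
  forall q, D q = 0 -> ip (v - p) q = 0.
Proof.
have [r [K [Kfree KE]]] : exists r (K : 'M[R]_(r, n)),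
    row_free K /\ (K :=: kermx (lin1_mx D))%MS.
  exists (\rank (kermx (lin1_mx D))), (row_base (kermx (lin1_mx D))).
  by split; [exact: row_base_free|exact: eq_row_base].
pose G := gram ip.
have ipE x y : ip x y = (x *m G *m y^T) 0 0.
  by rewrite ip_gram [RHS]mxE; apply: eq_bigr => j _; rewrite [_^T _ _]mxE.
have kerP q : D q = 0 -> exists w, q = w *m K.
  move=> Dq; have : (q <= K)%MS.
    by rewrite KE; apply/sub_kermxP; rewrite mul_rV_lin1.
  by move=> /submxP [w ->]; exists w.
have KD w : D (w *m K) = 0.
  rewrite -mul_rV_lin1; apply/sub_kermxP.
  by rewrite (submx_trans (submxMl _ _))// KE.
have Gk : K *m G *m K^T \in unitmx.
  rewrite -row_free_unit; apply: inj_row_free => w w0.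
  have : ip (w *m K) (w *m K) = 0.
    by rewrite ipE trmx_mul !mulmxA -(mulmxA w) -(mulmxA w) w0 mul0mx mxE.
  move=> /eqP; rewrite -ipnorm_sqr sqrf_eq0 ipnorm_eq0 => /eqP wK.
  by apply: (row_free_inj Kfree); rewrite wK mul0mx.
exists (v *m G *m K^T *m invmx (K *m G *m K^T) *m K); first exact: KD.
move=> q /kerP [w ->]; rewrite ipDl ipNl !ipE trmx_mul !mulmxA.
rewrite -(mulmxA _ K G) -(mulmxA _ (K *m G)) mulmxKV//.
by rewrite subrr.
Qed.

Lemma proj_kernel D v (p := Defs.proj ip [set q | D q = 0] v) :
  D p = 0 /\ forall q, D q = 0 -> ip (v - p) q = 0.
Proof.
have [p0 Dp0 orth] := kernel_orthogonal_split D v.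
have pyth q : D q = 0 ->
    ipnorm ip (v - q) ^+ 2 = ipnorm ip (v - p0) ^+ 2 + ipnorm ip (p0 - q) ^+ 2.
  move=> Dq; have := orth (p0 - q); rewrite linearB /= Dp0 Dq subrr => /(_ erefl) o.
  have -> : v - q = (v - p0) + (p0 - q) by rewrite addrA subrK.
  rewrite !ipnorm_sqr; move: (v - p0) (p0 - q) o => a b o.
  by rewrite ipDl !ipDr o (ipC ip b) o addr0 add0r.
have [Dp pmin] : D p = 0 /\ forall q, D q = 0 -> ipnorm ip (v - p) <= ipnorm ip (v - q).
  apply: (@xgetPex _ 0 [set p | D p = 0 /\
    forall q, D q = 0 -> ipnorm ip (v - p) <= ipnorm ip (v - q)]).
  exists p0; split => // q Dq.
  rewrite -(@ler_pXn2r _ 2) ?nnegrE ?ipnorm_ge0// (pyth q Dq).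
  by rewrite lerDl sqr_ge0.
suff -> : p = p0 by [].
apply/esym/eqP; rewrite -subr_eq0 -(ipnorm_eq0 ip) -sqrf_eq0.
have := pmin _ Dp0; rewrite -(@ler_pXn2r _ 2) ?nnegrE ?ipnorm_ge0// (pyth _ Dp).
by rewrite gerDl => h; rewrite eq_le h sqr_ge0.
Qed.

End Projection.

(** * Derivatives along segments *)

Section Slopes.
Variable (R : realType).

(** The mean value theorem between consecutive exceptional points. *)
Lemma le_slope_off_finite (g : R -> R) (s : seq R) (c a b : R) :
  continuous g -> a <= b ->
  (forall z, a < z < b -> z \notin s -> exists2 d, is_derive z (1 : R) g d & d <= c) ->
  g b - g a <= c * (b - a).
Proof.
move=> cg; elim: s a b => [|r s IH] a b ab H.
  have [->|ab'] := eqVneq a b; first by rewrite !subrr mulr0.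
  have {}ab : a < b by rewrite lt_neqAle ab'.
  have [//|||z] := @MVT R g (fun z => 'D_1 g z) a b.
  - move=> z; rewrite in_itv /= => zab; have [//|d gd _] := H z zab.
    by apply: DeriveDef => //; case: gd.
  - exact: continuous_subspaceT.
  rewrite in_itv /= => zab ->; rewrite ler_pM2r ?subr_gt0//.
  have [//|d gd dc] := H z zab.
  by case: gd => _ ->.
have [arb|nr] := boolP (a < r < b); last first.
  apply: IH => // z zab zs; apply: H => //; rewrite inE negb_or zs andbT.
  by apply: contraNneq nr => <-.
have /andP[ar rb] := arb.
have h1 : g r - g a <= c * (r - a).
  apply: IH => [|z /andP[az zr] zs]; first exact: ltW.
  apply: H; first by rewrite az (lt_trans zr rb).
  by rewrite inE negb_or zs (lt_eqF zr).
have h2 : g b - g r <= c * (b - r).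
  apply: IH => [|z /andP[rz zb] zs]; first exact: ltW.
  apply: H; first by rewrite zb (lt_trans ar rz).
  by rewrite inE negb_or zs (gt_eqF rz).
lra.
Qed.

Lemma strict_diff_line_derive n (f : 'rV[R]_n -> R) x w (s : R) v :
  strict_diff id f (x + s *: w) v ->
  is_derive s (1 : R) (fun t => f (x + t *: w)) (\sum_j w 0 j * v j).
Proof.
move=> [sl slv fs]; set z := x + s *: w in slv fs *.
have zc : z + h *: w @[h --> 0^'] --> z.
  apply: cvg_within_filter.
  suff : (fun h : R => z + h *: w) @ 0 --> z + 0 *: w by rewrite scale0r addr0.
  by apply: cvgD; [exact: cvg_cst|exact: (cvgZ cvg_id (cvg_cst _))].
have zz : (z, z + h *: w) @[h --> 0^'] --> (z, z).
  exact: (@cvg_pair _ _ _ _ (nbhs z) (nbhs z) _ _ _ (fun=> z) _ (cvg_cst _) zc).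
pose g (t : R) := f (x + t *: w).
have dg : h^-1 *: (g (h *: 1 + s) - g s) @[h --> 0^'] --> \sum_j w 0 j * v j.
  apply: (@near_cvg_to _ _ _ _ _ (fun h => \sum_j w 0 j * sl j (z, z + h *: w))).
    near=> h.
    have h0 : h != 0 by near: h; exact: nbhs_dnbhs_neq.
    have -> : g (h *: 1 + s) - g s = f (z + h *: w) - f z.
      rewrite /g /z -[h *: 1]/(h * 1) mulr1; congr (f _ - _).
      by rewrite scalerDl [h *: w + _]addrC addrA.
    have -> : f (z + h *: w) - f z =
        \sum_j ((z + h *: w) 0 j - z 0 j) * sl j (z, z + h *: w).
      near: h; exact: zz _ fs.
    rewrite scaler_sumr; apply: eq_bigr => j _; rewrite !mxE.
    rewrite -[_ *: _]/(_ * _); field; exact: h0.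
  apply: cvg_sumr => j; apply: cvgM; first exact: cvg_cst.
  exact: cvg_comp _ _ zz (slv j).
by apply: DeriveDef; [apply/cvg_ex; exists (\sum_j w 0 j * v j)|exact/cvg_lim].
Unshelve. all: by end_near. Qed.

End Slopes.

(** * The Riemannian gradient on the critical set *)

Section Critical.
Variables (R : realType) (n : nat) (ip : {dot 'rV[R]_n for idfun}).
Implicit Types (S U V : set 'rV[R]_n) (x y z v w : 'rV[R]_n).
Implicit Types (f : 'rV[R]_n -> R).
Local Notation N := (ipnorm ip).

Lemma locally_lipschitz_continuous f : locally_lipschitz f -> continuous f.
Proof.
move=> fl x; have [k [U xU lipU]] := fl x.
apply/(@cvgrPdist_lt _ _ _ (nbhs x)) => e e0.
have d0 : 0 < e / (`|k| + 1) by rewrite divr_gt0// ltr_wpDl.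
near=> y.
have Uy : U y by near: y.
have xy : `|x - y| < e / (`|k| + 1).
  by near: y; exact: (cvgr_dist_lt _ _ (cvg_id : id @ x --> x)).
have /= := lipU (x, y) (conj (nbhs_singleton xU) Uy).
move=> /le_lt_trans; apply.
apply: (@le_lt_trans _ _ (`|k| * `|x - y|)).
  by rewrite ler_wpM2r// ler_norm.
apply: (@le_lt_trans _ _ (`|k| * (e / (`|k| + 1)))).
  by rewrite ler_wpM2l// ltW.
by rewrite mulrCA gtr_pMr// ltr_pdivrMr ?mul1r ?ltrDl// ltr_wpDl.
Unshelve. all: by end_near. Qed.

Lemma meval_line (q : mpoly n R) x w :
  exists p : {poly R}, forall s, p.[s] = meval ((x + s *: w) 0) q.
Proof.
elim/mpoly_ring_ind: q => [c|i|q1 q2 [p1 h1] [p2 h2]|q1 q2 [p1 h1] [p2 h2]].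
- by exists c%:P => s; rewrite hornerC mevalC.
- by exists ((x 0 i)%:P + (w 0 i) *: 'X) => s; rewrite !hornerE mevalXU !mxE mulrC.
- by exists (p1 + p2) => s; rewrite hornerD mevalD h1 h2.
- by exists (p1 * p2) => s; rewrite hornerM mevalM h1 h2.
Qed.

(** Suppose that the Riemannian gradient [g] at the critical point [y] is not zero.
    By the Verdier inequality the subgradients at points near [y] outside [S] have
    an inner product at least [b > 0] with [g].  The same holds for the gradients at
    smooth points of [S]: such a gradient is zero, but by continuity it is also the
    limit of gradients at smooth points outside [S].  So [f] decreases with slope at
    least [b] along [- g], first on segments which meet the zeros of [q] at finitely
    many points only, then by density on all segments near [y].  Hence the
    Clarke derivative of [f] at [y] in the direction [- g] is negative, although 0 is
    a subgradient at [y]. *)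
Lemma riemannian_gradient_critical m (q : mpoly n R) (v : 'rV[R]_n -> 'I_n -> R)
    f x U (phi : 'rV[R]_n -> 'rV[R]_(n - m)) y V (c : R)
    (S := critical ip f) (g := riemannian_gradient ip S f y) :
  (m < n)%N -> continuous f -> q != 0 ->
  (forall x, meval (x 0) q != 0 -> strict_diff id f x (v x)) ->
  (forall x, meval (x 0) q != 0 -> forall j, {for x, continuous (v ^~ j)}) ->
  defining_map 1 S x U phi -> S y -> U y -> nbhs y V -> 0 < c ->
  (forall z w, V z -> ~ S z -> clarke ip f z w ->
     N (Defs.proj ip (tangent S y) w - g) <= c * N (z - y)) ->
  g = 0.
Proof.
move=> mn cf q0 fv cv dphi Sy Uy yV c0 verd.
apply/eqP; rewrite -(ipnorm_eq0 ip); apply/negP => /negP; rewrite ipnorm_eq0.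
rewrite -(ipnorm_gt0 ip) => g0.
have TE := tangentE (ltnW mn) dphi Sy Uy.
have gT : 'd phi y g = 0.
  have : [set w | 'd phi y w = 0] g.
    rewrite /g /riemannian_gradient.
    case: xgetP => [_ _ [h _ <-]|_]; last exact: linear0.
    by rewrite TE; exact: (proj_kernel ip ('d phi y) _).1.
  by [].
pose b := N g ^+ 2 / 2.
have b0 : 0 < b by rewrite divr_gt0// exprn_gt0.
have [r r0 rV] : exists2 r : R, 0 < r & forall z, N (z - y) < r ->
    [/\ V z, U z & c * N (z - y) <= N g / 2].
  have [oU _ _ _] := dphi.
  have yVU : nbhs y (V `&` U).
    by apply: filterI => //; apply: open_nbhs_nbhs; split => //; exact: oU.1.
  have [r r0 rVU] := nbhs_ipball ip yVU.
  exists (Num.min r (N g / 2 / c)).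
    by rewrite lt_min r0 !divr_gt0.
  move=> z; rewrite lt_min => /andP[zr zc].
  have [Vz Uz] := rVU z (ltW zr); split => //.
  by rewrite mulrC -ler_pdivlMr// ltW.
have outsideS z w : N (z - y) < r -> ~ S z -> clarke ip f z w -> b <= ip w g.
  move=> zr nSz cw; have [Vz _ cz] := rV z zr.
  have := verd z w Vz nSz cw; rewrite TE.
  have [Dp orth] := proj_kernel ip ('d phi y) w.
  set p := Defs.proj _ _ _ in Dp orth * => pg.
  have -> : ip w g = ip g g + ip (p - g) g.
    have := orth g gT; rewrite ipDl ipNl => /eqP; rewrite subr_eq0 => /eqP ->.
    by rewrite ipDl ipNl; ring.
  rewrite -ipnorm_sqr /b.
  have h1 := ip_cauchy_schwarz_norm ip (p - g) g.
  have h2 : N (p - g) * N g <= N g / 2 * N g.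
    exact: ler_wpM2r (ipnorm_ge0 ip g) _ _ (le_trans pg cz).
  have h3 := ler_norm (- ip (p - g) g); rewrite normrN in h3.
  have h4 : N g ^+ 2 = N g * N g by rewrite expr2.
  lra.
have smooth z : N (z - y) < r -> meval (z 0) q != 0 -> b <= ip (riesz ip (v z)) g.
  move=> zr zq; have [Sz|nSz] := pselect (S z); last first.
    exact: outsideS zr nSz ((strict_diff_clarke ip _ (fv _ zq)).2 erefl).
  have rz0 : riesz ip (v z) = 0.
    by apply/esym/(strict_diff_clarke ip 0 (fv _ zq)).
  exfalso.
  have ch : (fun z' => ip (riesz ip (v z')) g) @ z --> 0.
    have -> : 0 = ip (riesz ip (v z)) g by rewrite rz0 ip0l.
    rewrite ip_riesz.
    apply: (near_cvg_to (nbhs_filter z)); last first.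
      apply: (cvg_sumr (nbhs_filter z)) => j.
      by apply: cvgM; [exact: cvg_cst|exact: (cv z zq j)].
    by near=> z'; rewrite ip_riesz.
  have zW : nbhs z (fun z' => [/\ ip (riesz ip (v z')) g < b,
      meval (z' 0) q != 0 & N (z' - y) < r]).
    near=> z'; split; near: z'.
    - exact: (cvgr_lt _ ch _ b0).
    - exact: (@cvgr_neq0 _ _ _ (nbhs z) _ _ _ (@meval_continuous _ _ q z) zq).
    - have e0 : 0 < (r - N (z - y)) / 2 by rewrite divr_gt0// subr_gt0.
      apply: filterS (ipball_nbhs ip z e0) => z' /= zz'.
      apply: le_lt_trans (ipnorm_distD ip z z' y) _.
      have zz'' : N (z' - z) <= (r - N (z - y)) / 2 := zz'.
      lra.
  have [_ Uz _] := rV z zr.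
  have [z' [lt qz' z'r] nSz'] := defining_map_complement_dense mn dphi Sz Uz zW.
  have : b <= ip (riesz ip (v z')) g.
    exact: outsideS z'r nSz' ((strict_diff_clarke ip _ (fv _ qz')).2 erefl).
  by rewrite leNgt lt.
have segment x' t : meval (x' 0) q != 0 -> 0 <= t ->
    (forall s, 0 <= s <= t -> N (x' + s *: (- g) - y) < r) ->
    f (x' + t *: (- g)) - f x' <= - b * t.
  move=> xq t0 seg; have [p pE] := meval_line q x' (- g).
  have p0 : p != 0.
    apply: contraNneq xq => p0; have := pE 0.
    by rewrite p0 horner0 scale0r addr0 => <-.
  have [s sroots] := poly_roots_seq p0.
  have := @le_slope_off_finite R (fun s => f (x' + s *: (- g))) s (- b) 0 t.
  rewrite scale0r addr0 subr0; apply => //.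
    move=> s'.
    apply: (@continuous_comp _ _ _ (fun s : R => x' + s *: (- g)) f); last exact: cf.
    by apply: cvgD; [exact: cvg_cst|exact: (cvgZ cvg_id (cvg_cst _))].
  move=> z /andP[z0 zt] zs.
  have qz : meval ((x' + z *: (- g)) 0) q != 0.
    by rewrite -pE; apply: contra zs => pz; apply: sroots; rewrite rootE.
  exists (\sum_j (- g) 0 j * v (x' + z *: (- g)) j).
    exact: strict_diff_line_derive (fv _ qz).
  rewrite -(ip_riesz ip _ (- g)) ipNr lerN2; apply: smooth => //.
  by apply: seg; rewrite !ltW.
have dd : (clarke_dd f y (- g) <= (- b)%:E)%E.
  apply: clarke_dd_le.
  have h0 : 0 < r / 2 / (N g + 1).
    by rewrite !divr_gt0// ltr_wpDl// ltW.
  have F1 : \forall p \near filter_prod (nbhs y) (0 : R)^'+, N (p.1 - y) < r / 2.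
    exists ([set z | N (z - y) < r / 2], setT) => /=; last by move=> [z t] [].
    split; last exact: filterT.
    have e0 : 0 < r / 4 by rewrite divr_gt0.
    apply: filterS (ipball_nbhs ip y e0) => z' /= zz'.
    apply: (@le_lt_trans _ _ (r / 4)) => //; lra.
  have F2 : \forall p \near filter_prod (nbhs y) (0 : R)^'+,
      0 < p.2 < r / 2 / (N g + 1).
    exists (setT, [set t | 0 < t < r / 2 / (N g + 1)]) => /=; last by move=> [z t] [].
    split; first exact: filterT.
    near=> t; apply/andP; split; near: t; first exact: nbhs_right_gt.
    exact: nbhs_right_lt.
  apply: filterS2 F1 F2 => p p1 /andP[p20 p2]; rewrite leNgt; apply/negP => ltp.
  pose Fh (x' : 'rV[R]_n) := f (x' + p.2 *: (- g)) - f x'.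
  have cF1 : {for p.1, continuous (fun z => f (z + p.2 *: (- g)))}.
    apply: (@continuous_comp _ _ _ (fun z : 'rV[R]_n => z + p.2 *: (- g)) f).
      exact: (cvgD (cvg_id : id @ p.1 --> p.1) (cvg_cst (p.2 *: (- g)))).
    exact: cf.
  have cF : {for p.1, continuous Fh} by exact: (cvgB cF1 (cf p.1)).
  have nW : nbhs p.1 (fun z => - b * p.2 < Fh z /\ N (z - y) < r / 2).
    near=> z; split; near: z; first exact: (cvgr_gt _ cF _ ltp).
    have e0 : 0 < (r / 2 - N (p.1 - y)) / 2 by rewrite divr_gt0// subr_gt0.
    apply: filterS (ipball_nbhs ip p.1 e0) => z' /= zz'.
    apply: le_lt_trans (ipnorm_distD ip p.1 z' y) _.
    have zz'' : N (z' - p.1) <= (r / 2 - N (p.1 - y)) / 2 := zz'.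
    lra.
  have [x' [ltx' x'r] qx'] := mpoly_nonzeros_dense q0 nW.
  have := segment x' p.2 qx' (ltW p20).
  rewrite leNgt ltx' => noseg; suff : false by [].
  apply: noseg => s /andP[s0 sp].
  have -> : x' + s *: (- g) - y = (x' - y) - s *: g by rewrite scalerN addrAC.
  apply: le_lt_trans (ipnormB ip _ _) _; rewrite ipnormZ ger0_norm//.
  have : s * N g <= r / 2.
    apply: (@le_trans _ _ (p.2 * (N g + 1))).
      by apply: ler_pM => //; rewrite ?ipnorm_ge0 ?lerDl.
    by rewrite -ler_pdivlMr ?ltr_wpDl ?ipnorm_ge0// ltW.
  lra.
have := Sy (- g); rewrite ip0l => /le_trans /(_ dd).
by rewrite lee_fin leNgt oppr_lt0 b0.
Unshelve. all: by end_near. Qed.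

End Critical.

(** * The distance to a manifold *)

Section Distance.
Variables (R : realType) (n : nat) (ip : {dot 'rV[R]_n for idfun}).
Implicit Types (S U V : set 'rV[R]_n) (x y z v w : 'rV[R]_n).
Local Notation N := (ipnorm ip).

(** Meant for nonempty [S]; it is 0 if [S] is empty. *)
Definition rdist S x : R := fine (dist ip x S).

Lemma rdistE S x : S !=set0 -> dist ip x S = (rdist S x)%:E.
Proof.
move=> [z Sz]; rewrite /rdist fineK// fin_numE; apply/andP; split.
  rewrite gt_eqF// (@lt_le_trans _ _ 0%E) ?ltNy0//.
  apply: le_ereal_inf_tmp => _ [y _ <-].
  by rewrite lee_fin ipnorm_ge0.
rewrite lt_eqF// (@le_lt_trans _ _ (N (x - z))%:E) ?ltry//.
by apply: ereal_inf_lbound; exists z.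
Qed.

Lemma rdist_ge0 S x : 0 <= rdist S x.
Proof.
apply: fine_ge0; apply: le_ereal_inf_tmp => _ [y _ <-].
by rewrite lee_fin ipnorm_ge0.
Qed.

Lemma rdist_le S x z : S z -> rdist S x <= N (x - z).
Proof.
move=> Sz; rewrite -lee_fin -rdistE; last by exists z.
by apply: ereal_inf_lbound; exists z.
Qed.

Lemma le_rdist S x (c : R) : S !=set0 ->
  (forall z, S z -> c <= N (x - z)) -> c <= rdist S x.
Proof.
move=> S0 H; rewrite -lee_fin -rdistE//.
by apply: le_ereal_inf_tmp => _ [y Sy <-]; rewrite lee_fin H.
Qed.

Lemma rdist_adherent S x (e : R) : S !=set0 -> 0 < e ->
  exists2 z, S z & N (x - z) < rdist S x + e.
Proof.
move=> S0 e0; have fin : ereal_inf [set (N (x - y))%:E | y in S] \is a fin_num.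
  by rewrite -/(dist ip x S) rdistE.
have [_ [z Sz <-]] := lb_ereal_inf_adherent e0 fin.
by rewrite -/(dist ip x S) rdistE// -EFinD lte_fin; exists z.
Qed.

Lemma rdist_gt0 p m S x0 U (phi : 'rV[R]_n -> 'rV[R]_(n - m)) x :
  S !=set0 -> defining_map p S x0 U phi -> {for x, continuous phi} ->
  U x -> ~ S x -> 0 < rdist S x.
Proof.
move=> S0 dphi cphi Ux nSx.
have [[oU _] _ _ _] := dphi.
have phix : phi x != 0 by apply/eqP => /(defining_map_zero dphi Ux).
have nV : nbhs x (fun z => phi z != 0 /\ U z).
  near=> z; split; near: z.
    exact: (@cvgr_neq0 _ _ _ (nbhs x) _ _ _ cphi phix).
  by apply: open_nbhs_nbhs.
have [e e0 eV] := nbhs_ipball ip nV.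
apply: (lt_le_trans e0); apply: le_rdist => // z Sz; rewrite leNgt; apply/negP => xz.
have [|phiz Uz] := eV z; first by rewrite /ipball /= ipnorm_sym ltW.
by move/eqP: phiz; apply; apply/(defining_map_zero dphi Uz).
Unshelve. all: by end_near. Qed.

(** The map [w |-> D (w *m B)] is so close to the identity that it is invertible,
    with an inverse of norm at most 2. *)
Lemma perturbed_right_inverse k (D0 D : {linear 'rV[R]_n -> 'rV[R]_k})
    (B : 'M[R]_(k, n)) (b e : R) :
  (forall w : 'rV[R]_k, D0 (w *m B) = w) ->
  (forall w : 'rV[R]_k, `|w *m B| <= b * `|w|) ->
  0 <= e -> e * b <= 2^-1 -> (forall u, `|D u - D0 u| <= e * `|u|) ->
  forall r, exists2 w : 'rV[R]_k, D (w *m B) = r & `|w| <= 2 * `|r|.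
Proof.
move=> HB Bb e0 eb DD0 r.
pose M := B *m lin1_mx D.
have ME (w : 'rV[R]_k) : w *m M = D (w *m B) by rewrite /M mulmxA mul_rV_lin1.
have Mw (w : 'rV[R]_k) : `|w| <= 2 * `|w *m M|.
  have h3 : `|w *m M - w| <= 2^-1 * `|w|.
    rewrite ME -{2}(HB w); apply: le_trans (DD0 _) _.
    by apply: (@le_trans _ _ (e * (b * `|w|))); rewrite ?ler_wpM2l// mulrA ler_wpM2r.
  have h4 : `|w| <= `|w *m M| + `|w *m M - w|.
    by rewrite -{1}(subKr (w *m M) w); exact: ler_normB.
  lra.
have Mu : M \in unitmx.
  rewrite -row_free_unit; apply: inj_row_free => w wM.
  by have := Mw w; rewrite wM normr0 mulr0 normr_le0 => /eqP.
exists (r *m invmx M); first by rewrite -ME mulmxKV.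
by have := Mw (r *m invmx M); rewrite mulmxKV.
Qed.

(** Chords of [S] near [x] are almost tangent to [S] at their origin, uniformly: the
    differential at [y] is small on [z - y] and has a right inverse which is bounded
    independently of [y], so that a small correction puts [z - y] in its kernel. *)
Lemma defining_map_near_tangent m S x U (phi : 'rV[R]_n -> 'rV[R]_(n - m)) (d : R) :
  defining_map 1 S x U phi -> 0 < d ->
  exists2 r : R, 0 < r & forall y z, N (y - x) < r -> N (z - x) < r ->
    S y -> S z -> U y /\ exists2 t, 'd phi y t = 0 & N (z - y - t) <= d * N (z - y).
Proof.
move=> dphi d0; have [xU c1 _ surj] := dphi.
have [B HB] := diff_right_inverse (surj _ xU.2).
pose b := (n - m)%N%:R * `|B| + 1.
have b0 : 0 < b by rewrite ltr_wpDl// mulr_ge0.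
have Bb (w : 'rV[R]_(n - m)) : `|w *m B| <= b * `|w|.
  apply: le_trans (mulmx_norm_le _ _) _.
  by rewrite mulrC ler_wpM2r// lerDl.
have [c1' c10 Nle] := ipnorm_le_norm ip.
have [c2 c20 leN] := norm_le_ipnorm ip.
pose e := Num.min (2 * b)^-1 (d / (4 * c1' * b * c2)).
have e0 : 0 < e.
  by rewrite lt_min; apply/andP; split; rewrite ?invr_gt0 ?divr_gt0// !mulr_gt0.
have eb : e * b <= 2^-1.
  apply: (@le_trans _ _ ((2 * b)^-1 * b)).
    by rewrite ler_wpM2r ?(ltW b0)// ge_min lexx.
  by rewrite invfM -mulrA mulVf ?mulr1// gt_eqF.
have ed : 4 * c1' * b * c2 * e <= d.
  have q0 : 0 < 4 * c1' * b * c2 by rewrite !mulr_gt0.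
  by rewrite mulrC -ler_pdivlMr// ge_min lexx orbT.
have [[V1 V2] /= [V1x V2x] V12] := C1_strict_bound c1 xU e0.
have dV := C1_diff_bound c1 xU e0.
have xV : nbhs x ((V1 `&` V2) `&`
    ([set y | forall w, `|'d phi y w - 'd phi x w| <= e * `|w|] `&` U)).
  apply: filterI; first exact: filterI.
  by apply: filterI => //; exact: open_nbhs_nbhs.
have [r r0 rV] := nbhs_ipball ip xV.
exists r => // y z yr zr Sy Sz.
have [[V1y _] [dy Uy]] := rV y (ltW yr).
have [[_ V2z] [_ Uz]] := rV z (ltW zr).
split=> //.
have phiy : phi y = 0 by apply/(defining_map_zero dphi Uy).
have phiz : phi z = 0 by apply/(defining_map_zero dphi Uz).
have := V12 (y, z) (conj V1y V2z); rewrite /= phiy phiz subrr sub0r normrN => h1.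
have tri (a c : 'rV[R]_(n - m)) : `|a| <= `|a - c| + `|c|.
  by rewrite -{1}(subrK c a) ler_normD.
have h2 : `|'d phi y (z - y)| <= 2 * e * `|z - y|.
  apply: le_trans (tri _ ('d phi x (z - y))) _.
  apply: le_trans (lerD (dy (z - y)) h1) _.
  by rewrite -mulrDl mulr_natl mulr2n.
have [w wM h6] := perturbed_right_inverse HB Bb (ltW e0) eb dy ('d phi y (z - y)).
exists (z - y - w *m B).
  by have := linearB ('d phi y) (z - y) (w *m B) => ->; rewrite wM subrr.
rewrite subKr; apply: le_trans (Nle _) _.
have h5 := Bb w.
have h7 := leN (z - y).
apply: (@le_trans _ _ (c1' * (b * (2 * (2 * e * (c2 * N (z - y))))))).
  rewrite ler_wpM2l ?(ltW c10)//; apply: le_trans h5 _.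
  rewrite ler_wpM2l ?(ltW b0)//; apply: le_trans h6 _.
  rewrite ler_wpM2l//; apply: le_trans h2 _.
  by rewrite ler_wpM2l// mulr_ge0// ltW.
have -> : c1' * (b * (2 * (2 * e * (c2 * N (z - y))))) =
   4 * c1' * b * c2 * e * N (z - y) by ring.
by rewrite ler_wpM2r ?ipnorm_ge0.
Qed.

Lemma small_powR (K t : R) : 0 <= K -> 1 < t ->
  exists2 eta : R, 0 < eta & forall d, 0 < d -> d < eta -> K * d `^ t < d.
Proof.
move=> K0 t1; have s0 : 0 < t - 1 by rewrite subr_gt0.
pose eta := ((K + 1)^-1) `^ (t - 1)^-1.
have K1 : 0 < K + 1 by rewrite ltr_wpDl.
exists eta; first by rewrite powR_gt0// invr_gt0.
move=> d d0 deta.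
have -> : d `^ t = d * d `^ (t - 1).
  by rewrite -[X in X * _]powRr1 ?(ltW d0)// -powRD ?subrKC// (gt_eqF d0) implybT.
have h : d `^ (t - 1) <= (K + 1)^-1.
  have -> : (K + 1)^-1 = eta `^ (t - 1).
    by rewrite -powRrM mulVf ?gt_eqF// powRr1// invr_ge0 ltW.
  by rewrite ge0_ler_powR ?nnegrE ?(ltW s0) ?(ltW d0) ?powR_ge0 ?(ltW deta).
apply: (@le_lt_trans _ _ (K * (d * (K + 1)^-1))).
  by rewrite ler_wpM2l// ler_wpM2l// ltW.
by rewrite mulrCA gtr_pMr// ltr_pdivrMr// mul1r ltrDl.
Qed.

End Distance.

(** * One step of the method near the critical set *)

Section Step.
Variables (R : realType) (n : nat) (ip : {dot 'rV[R]_n for idfun}).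
Implicit Types (S U V : set 'rV[R]_n) (x y z v w s : 'rV[R]_n).
Implicit Types (f : 'rV[R]_n -> R).
Local Notation N := (ipnorm ip).

Lemma subregular_bound f x (t : R) :
  metrically_subregular ip ip (clarke ip f) x 0 t -> 0 < t ->
  exists2 c : R, 0 < c & \forall z \near x, forall s, clarke ip f z s ->
    rdist ip (critical ip f) z <= c * N s `^ t.
Proof.
move=> [Sx [U [c [xU c0] Hc]]] t0; exists c => //.
near=> z => s zs.
have Uz : U z by near: z.
have S0 : critical ip f !=set0 by exists x.
have := Hc z Uz; rewrite -/(critical ip f) (rdistE ip _ S0) => h.
rewrite -lee_fin; apply: le_trans h _.
rewrite EFinM lee_pmul2l ?lte_fin//.
rewrite -poweR_EFin.
have F0 : clarke ip f z !=set0 by exists s.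
rewrite (rdistE ip _ F0) !poweR_EFin lee_fin.
rewrite ge0_ler_powR ?nnegrE ?(ltW t0) ?rdist_ge0 ?ipnorm_ge0//.
by have := rdist_le ip 0 zs; rewrite sub0r ipnormN.
Unshelve. all: by end_near. Qed.

Lemma subregular_powR (k t M d r : R) : 0 <= k -> 0 <= t -> 0 <= M -> 0 <= d ->
  0 <= r -> r <= M * d -> k * r `^ t <= k * M `^ t * d `^ t.
Proof.
move=> k0 t0 M0 d0 r0 rM; rewrite -mulrA ler_wpM2l// -powRM//.
by rewrite ge0_ler_powR ?nnegrE// mulr_ge0.
Qed.

(** The geometry of a step.  Here [x] is at distance about [d] from its almost nearest
    point [y] of [S], [p] is the tangential part at [y] of the subgradient [s], and
    [z] is another point of [S], reached from [y] along the tangent vector [tau] with an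
    error of at most half of the length of the chord.  The normal part [s - p] of [s] is long, so the step leaves
    the affine tangent space at [y] by much more than [z] can follow: this is seen by
    taking the inner product of [x - a *: s - z] with [s - p].  In the lower bound on
    [N s] the term [4 * c] absorbs the tangential part, and 14 is large enough to
    leave [8 / 3 * d] at the end. *)
Lemma step_away_estimate x y z s p tau (a c d : R) :
  0 < a -> 0 < c -> 0 < d -> N (x - y) <= 2 * d -> N p <= 2 * c * d ->
  ip (s - p) p = 0 -> ip (s - p) tau = 0 ->
  N (z - y - tau) <= 2^-1 * N (z - y) -> (4 * c + 14 / a) * d <= N s ->
  2 * d <= N (x - a *: s - z).
Proof.
move=> a0 c0 d0 xy pcd orthp orthtau htau sM.
set x' := x - a *: s; pose nu := s - p.
have snu : N s <= N nu + N p by rewrite -{1}(subrK p s) ipnormD.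
have cd0 : 0 < c * d by rewrite mulr_gt0.
have ad0 : 0 < 14 / a * d by rewrite !mulr_gt0 ?invr_gt0.
have nu0 : 0 < N nu by lra.
have ipsnu : ip s nu = N nu ^+ 2.
  by rewrite ipnorm_sqr -{1}(subrK p s) ipDl -/nu (ipC ip p) orthp addr0.
have key : a * N nu ^+ 2 <=
    N (x' - z) * N nu + 2 * d * N nu + 2^-1 * N (z - y) * N nu.
  have E1 : ip (x' - z) nu = ip (x - y) nu - a * ip s nu - ip (z - y - tau) nu.
    have -> : x' - z = (x - y) - a *: s - (z - y - tau) - tau.
      by rewrite /x'; apply/rowP => i; rewrite !mxE; ring.
    rewrite [LHS]ipDl [ip (- tau) _]ipNl (ipC ip tau) orthtau subr0.
    by rewrite ipDl ipNl [ip (x - y - _) _]ipDl ipNl ipZl.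
  have h1 := ip_cauchy_schwarz_norm ip (x' - z) nu.
  have h2 := ip_cauchy_schwarz_norm ip (x - y) nu.
  have h3 := ip_cauchy_schwarz_norm ip (z - y - tau) nu.
  have h4 : N (x - y) * N nu <= 2 * d * N nu by rewrite ler_wpM2r ?(ltW nu0).
  have h5 : N (z - y - tau) * N nu <= 2^-1 * N (z - y) * N nu.
    by rewrite ler_wpM2r ?(ltW nu0).
  move: h1 h2 h3; rewrite !ler_norml => /andP[h1 _] /andP[_ h2] /andP[h3 _].
  rewrite ipsnu in E1; lra.
have key2 : a * N nu <= N (x' - z) + 2 * d + 2^-1 * N (z - y).
  rewrite -(ler_pM2r nu0); lra.
have zy : N (z - y) <= N (x' - z) + a * N s + 2 * d.
  have -> : z - y = - (x' - z) - a *: s + (x - y).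
    by rewrite /x'; apply/rowP => i; rewrite !mxE; ring.
  apply: le_trans (ipnormD ip _ _) _; apply: lerD => //.
  by apply: le_trans (ipnormB ip _ _) _; rewrite ipnormN ipnormZ gtr0_norm.
have aM : a * ((4 * c + 14 / a) * d) <= a * N s by rewrite ler_wpM2l ?(ltW a0).
have aM2 : a * ((4 * c + 14 / a) * d) = 4 * (a * (c * d)) + 14 * d.
  by field; rewrite gt_eqF.
have as1 : a * N s <= a * N nu + a * (2 * c * d).
  by rewrite -mulrDr ler_wpM2l ?(ltW a0)//; lra.
have acd : 0 < a * (c * d) by rewrite mulr_gt0.
lra.
Qed.

(** At a point at small distance [d] from [S], metric subregularity of order [t > 1]
    bounds [d] by a multiple of [N s `^ t], so [s] is longer than any given multiple
    of [d].  As the Riemannian gradient of [f] vanishes on [S], the Verdier inequality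
    says that the tangential part of [s] is at most a fixed multiple of [d].  So [s] is
    almost normal to [S] and long, and the step doubles the distance. *)
Lemma distance_doubling m f x0 U (phi : 'rV[R]_n -> 'rV[R]_(n - m)) (t : R)
    (S := critical ip f) (q : mpoly n R) (v : 'rV[R]_n -> 'I_n -> R) :
  (m < n)%N -> continuous f -> q != 0 ->
  (forall x, meval (x 0) q != 0 -> strict_diff id f x (v x)) ->
  (forall x, meval (x 0) q != 0 -> forall j, {for x, continuous (v ^~ j)}) ->
  defining_map 1 S x0 U phi -> S x0 -> 1 < t ->
  metrically_subregular ip ip (clarke ip f) x0 0 t -> verdier ip f x0 S ->
  exists2 e : R, 0 < e & forall a : R, 0 < a ->
    exists2 eta : R, 0 < eta & forall x s, N (x - x0) <= e ->
      N (x - a *: s - x0) <= e -> clarke ip f x s -> ~ S x ->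
      0 < rdist ip S x -> rdist ip S x < eta ->
      2 * rdist ip S x <= rdist ip S (x - a *: s).
Proof.
move=> mn cf q0 fv cv dphi Sx0 t1 sub [_ _ [V [c [x0V c0] verd]]].
have [cm cm0 Hcm] := subregular_bound sub (lt_trans ltr01 t1).
have half0 : 0 < 2^-1 :> R by rewrite invr_gt0.
have [r1 r10 Hr1] := defining_map_near_tangent ip dphi half0.
have S0 : S !=set0 by exists x0.
have [[oU Ux0] _ _ _] := dphi.
have x0W : nbhs x0 (V `&` (U `&` [set z | forall s, clarke ip f z s ->
    rdist ip (critical ip f) z <= cm * N s `^ t])).
  by apply: filterI => //; apply: filterI => //; exact: open_nbhs_nbhs.
have [r2 r20 Hr2] := nbhs_ipball ip x0W.
have grad0 y : N (y - x0) < r2 -> S y -> riemannian_gradient ip S f y = 0.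
  move=> yr Sy; have [Vy [Uy _]] := Hr2 y (ltW yr).
  have yV : nbhs y V.
    have e0 : 0 < (r2 - N (y - x0)) / 2 by rewrite divr_gt0// subr_gt0.
    apply: filterS (ipball_nbhs ip y e0) => z /= yz.
    have yz' : N (z - y) <= (r2 - N (y - x0)) / 2 := yz.
    have [] // := Hr2 z; rewrite /ipball /=.
    by apply: le_trans (ipnorm_distD ip y z x0) _; lra.
  apply: (riemannian_gradient_critical mn cf q0 fv cv dphi Sy Uy yV c0).
  by move=> z w Vz nSz zw; apply: verd.
(* Points of [S] within [4 * e] of [x0] are under control; those farther away are
   at distance at least [3 * e] from the ball of radius [e]. *)
pose e := Num.min r1 r2 / 5.
have r0 : 0 < Num.min r1 r2 by rewrite lt_min r10 r20.
have e0 : 0 < e by rewrite divr_gt0.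
have er1 : 5 * e <= r1 by rewrite /e mulrC divfK ?ge_min ?lexx// pnatr_eq0.
have er2 : 5 * e <= r2 by rewrite /e mulrC divfK ?ge_min ?lexx ?orbT// pnatr_eq0.
exists e => // a a0.
pose M := 4 * c + 14 / a.
have M0 : 0 < M by rewrite addr_gt0 ?mulr_gt0 ?invr_gt0.
have K0 : 0 <= cm * M `^ t by rewrite mulr_ge0 ?powR_ge0// ltW.
have [eta eta0 Heta] := small_powR K0 t1.
exists eta; first exact: eta0.
move=> x s xe x'e xs nSx d0 deta.
set d := rdist ip S x in d0 deta *.
have d_e : d <= e by apply: le_trans (rdist_le ip x Sx0) xe.
have xr2 : ipball ip x0 r2 x by rewrite /ipball /=; lra.
have [Vx [_ xsub]] := Hr2 x xr2.
have sM : M * d <= N s.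
  rewrite leNgt; apply/negP => sM.
  have := xsub s xs; rewrite -/S -/d leNgt => /negP; apply.
  apply: le_lt_trans (Heta d d0 deta).
  exact: subregular_powR (ltW cm0) (ltW (lt_trans ltr01 t1)) (ltW M0) (ltW d0)
    (ipnorm_ge0 ip s) (ltW sM).
have [y Sy xy] := rdist_adherent ip x S0 d0; rewrite -/d in xy.
have yx0 : N (y - x0) <= 3 * e.
  apply: le_trans (ipnorm_distD ip x y x0) _; rewrite (ipnorm_sym ip y); lra.
set x' := x - a *: s in x'e *.
apply: le_rdist S0 _ => z Sz.
have [far|near] := leP (4 * e) (N (z - x0)).
  have := ipnorm_distD ip x' z x0; rewrite (ipnorm_sym ip z x') => h; lra.
have yr1 : N (y - x0) < r1 by lra.
have zr1 : N (z - x0) < r1 by lra.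
have [Uy [tau Dtau htau]] := Hr1 y z yr1 zr1 Sy Sz.
have yr2 : N (y - x0) < r2 by lra.
have TE := tangentE (ltnW mn) dphi Sy Uy.
have [Dp orth] := proj_kernel ip ('d phi y) s.
have Vy : V y by have [] := Hr2 y (ltW yr2).
have := verd y x s Sy Vy Vx nSx xs; rewrite TE (grad0 y yr2 Sy) subr0.
set p := Defs.proj _ _ _ in Dp orth * => pc.
have pxy : N p <= 2 * c * d.
  apply: le_trans pc _.
  have h : c * N (x - y) <= c * (d + d) by rewrite ler_wpM2l ?(ltW c0) ?(ltW xy).
  lra.
have xy2 : N (x - y) <= 2 * d by lra.
exact: (step_away_estimate a0 c0 d0 xy2 pxy (orth p Dp) (orth tau Dtau) htau sM).
Qed.

End Step.

(** * Strong instability *)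

Lemma defining_map_C1 (R : realType) (n m : nat) (S U : set 'rV[R]_n) x
    (phi : 'rV[R]_n -> 'rV[R]_(n - m)) :
  defining_map 2 S x U phi -> defining_map 1 S x U phi.
Proof. by move=> [xU c2 SU surj]; split => //; exact: C1_of_C2. Qed.

(** Near each of its points a component of the defining map can replace one of the
    coordinates, which sends [S] into a hyperplane. *)
Lemma defining_map_null (R : realType) (n m : nat) (S U : set 'rV[R]_n) x
    (phi : 'rV[R]_n -> 'rV[R]_(n - m)) :
  (m < n)%N -> defining_map 1 S x U phi -> lebesgue_null (S `&` U).
Proof.
move=> mn dphi; have n0 : (0 < n)%N by apply: leq_ltn_trans mn.
have [[oU _] c1 _ surj] := dphi.
have nm0 : (0 < n - m)%N by rewrite subn_gt0.
pose j := Ordinal nm0.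
pose A i := [set y | (S `&` U) y /\ 'd phi y (delta_mx 0 i) 0 j != 0].
apply: (@lebesgue_null_subset _ _ _ (\bigcup_i A i)).
  move=> y [Sy Uy]; have [u Du] := surj y Uy (const_mx 1).
  apply: contrapT => nA.
  have : 'd phi y u 0 j = 0.
    rewrite linear_coord_sum big1// => i _.
    have [->|di] := eqVneq ('d phi y (delta_mx 0 i) 0 j) 0; first by rewrite mulr0.
    by case: nA; exists i.
  by rewrite Du mxE => /eqP; rewrite oner_eq0.
apply: lebesgue_null_bigcup_countable => // i.
pose g := fun y : 'rV[R]_n => \row_l (if l == i then phi y 0 j else y 0 l).
apply: (@lebesgue_null_subset _ _ _ (A i `&` g @^-1` [set y : 'rV[R]_n | y 0 i = 0])).
  move=> y Ay; split => //=; rewrite mxE eqxx.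
  by have [[Sy Uy] _] := Ay; rewrite ((defining_map_zero dphi Uy).1 Sy) mxE.
apply: lebesgue_null_locally_expansive => //; last exact: lebesgue_null_hyperplane.
move=> y [[Sy Uy] di].
have yU : open_nbhs y U by [].
exact: (strict_diff_replace_expansive (C1_strict_diff j c1 yU) di).
Qed.

(** The points from which [A] is hit at the k-th iterate are obtained from [A] by
    pulling back [k] times. *)
Lemma null_hitting_set (R : realType) (n : nat) (ip : {dot 'rV[R]_n for idfun})
    (f : 'rV[R]_n -> R) (q r : mpoly n R) (v : 'rV[R]_n -> 'I_n -> R)
    (H : 'rV[R]_n -> 'M[R]_n) (alpha : R) (A : set 'rV[R]_n) :
  (0 < n)%N -> q != 0 -> r != 0 ->
  (forall x : 'rV[R]_n, meval (x 0) q != 0 -> strict_diff id f x (v x)) ->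
  (forall x : 'rV[R]_n, meval (x 0) q != 0 ->
     forall j, strict_diff id (fun y => v y j) x (H x ^~ j)) ->
  (forall x : 'rV[R]_n, meval (x 0) q != 0 -> meval (x 0) r != 0 ->
     \det (gram ip - alpha *: H x) != 0) ->
  lebesgue_null A ->
  lebesgue_null [set x0 | exists x k, [/\ x 0%N = x0,
    subgradient_method ip f alpha x & A (x k)]].
Proof.
move=> n0 q0 r0 fv vH detH nA.
pose B k := iter k (fun B => [set x : 'rV[R]_n |
  exists2 s, clarke ip f x s & B (x - alpha *: s)]) A.
apply: (@lebesgue_null_subset _ _ _ (\bigcup_k B k)).
  move=> x0 [x [k [<- xf Axk]]]; exists k => //.
  have H' i : (i <= k)%N -> B i (x (k - i)%N).
    elim: i => [|i IH] ik; first by rewrite subn0.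
    have [s xs xE] := xf (k - i.+1)%N.
    exists s => //; rewrite -xE -subSn// subSS.
    by apply: IH; exact: ltnW.
  by have := H' k (leqnn k); rewrite subnn.
apply: lebesgue_null_bigcup => k; elim: k => [//|k IH].
exact: (null_subgradient_preimage n0 q0 r0 fv vH detH IH).
Qed.

Lemma bounded_increments (R : realType) (a : nat -> R) (b d : R) : 0 < d ->
  (forall k, a k <= b) -> (forall k, a k <= a k.+1) ->
  (forall k, exists2 j, (k <= j)%N & a j + d <= a j.+1) -> False.
Proof.
move=> d0 ab anon jump.
have mono i j : (i <= j)%N -> a i <= a j.
  move/subnK => <-; elim: (j - i)%N => [//|l IH].
  by rewrite addSn; exact: le_trans IH (anon _).
have H N : exists k, a 0%N + N%:R * d <= a k.
  elim: N => [|N [k IH]]; first by exists 0%N; rewrite mul0r addr0.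
  have [j kj aj] := jump k; exists j.+1.
  have := mono _ _ kj; rewrite -natr1; lra.
have [k] := H (Num.truncn ((b - a 0%N) / d)).+1.
have := truncnS_gt ((b - a 0%N) / d); rewrite ltr_pdivrMr// => h1 h2.
have := ab k; lra.
Qed.

Theorem theorem1 (R : realType) (n m : nat) (ip : {dot 'rV[R]_n for idfun})
    (f : 'rV[R]_n -> R) (xstar : 'rV[R]_n)
    (f_lip : locally_lipschitz f) (f_semialg : semialgebraic_fun f)
    (m_lt_n : (m < n)%N) (S_manifold : manifold_at 2 m (critical ip f) xstar)
    (theta1 : R) (theta1_ge0 : 0 <= theta1)
    (U : set 'rV[R]_n) (U_nbhs : nbhs xstar U)
    (C : 'rV[R]_n -> R) (C_cont : continuous C)
    (C_incr : forall alpha : R, 0 < alpha ->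
       exists2 c1 : R, 0 < c1 &
         forall x : nat -> 'rV[R]_n,
           (forall k, (U `\` critical ip f) (x k)) ->
           subgradient_method ip f alpha x ->
           forall k, (c1%:E * poweR (dist ip (x k) (critical ip f)) theta1
                       <= (C (x k.+1) - C (x k))%:E)%E) :
  theta1 = 0 \/
  (exists2 theta2 : R, 1 < theta2 &
     metrically_subregular ip ip (clarke ip f) xstar 0 theta2) /\
  verdier ip f xstar (critical ip f) ->
  strongly_unstable ip f xstar.
Proof.
move=> cases.
set S := critical ip f in S_manifold C_incr cases *.
have [Sx _ [W [phi dphi2]]] := S_manifold.
have dphi := defining_map_C1 dphi2.
have [xW c1 _ _] := dphi.
have n0 : (0 < n)%N by exact: leq_ltn_trans m_lt_n.
have S0 : S !=set0 by exists xstar.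
have cf := locally_lipschitz_continuous f_lip.
have [P P0 Pf] := semialgebraic_fun_root f_semialg.
have [q [v [H [q0 fv vH detH]]]] := algebraic_generically_smooth cf P0 Pf.
have cv (x : 'rV[R]_n) : meval (x 0) q != 0 -> forall j, {for x, continuous (v ^~ j)}.
  by move=> xq j; exact: (strict_diff_continuous cvg_id (vH x xq j)).
have [|sroots Hs] := detH (gram ip).
  by rewrite -unitfE -unitmxE gram_unit.
have [e1 e10 He1] : exists2 e : R, 0 < e & forall a, 0 < a ->
    theta1 = 0 \/ exists2 eta : R, 0 < eta & forall x s, ipnorm ip (x - xstar) <= e ->
      ipnorm ip (x - a *: s - xstar) <= e -> clarke ip f x s -> ~ S x ->
      0 < rdist ip S x -> rdist ip S x < eta ->
      2 * rdist ip S x <= rdist ip S (x - a *: s).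
  case: cases => [->|[[t t1 sub] ver]].
    by exists 1 => // a _; left.
  have [e e0 He] := distance_doubling m_lt_n cf q0 fv cv dphi Sx t1 sub ver.
  by exists e => // a a0; right; exact: He.
have xV : nbhs xstar (U `&` (W `&` [set z | C z < C xstar + 1])).
  apply: filterI => //; apply: filterI; first exact: open_nbhs_nbhs.
  by apply: (cvgr_lt _ (C_cont xstar)); rewrite ltrDl.
have [e2 e20 He2] := nbhs_ipball ip xV.
pose e := Num.min e1 e2.
have e0 : 0 < e by rewrite lt_min e10 e20.
have ballU z : ipball ip xstar e z ->
    [/\ U z, W z, C z < C xstar + 1 & ipnorm ip (z - xstar) <= e1].
  rewrite /ipball /= le_min => /andP[z1 z2].
  by have [Uz [Wz Cz]] := He2 z z2.
exists e => //.
apply: (@sub_finite_set _ _ [set` sroots]); last exact: finite_seq.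
move=> a [a0 nnull] /=; apply: contra_notT nnull => as_.
(* The initial points of runs which stay in the ball form a null set: such a run
   hits [S], which is proved by contradiction. *)
have [r r0 Hr] := Hs a as_.
have nS := defining_map_null m_lt_n dphi.
apply: lebesgue_null_subset (null_hitting_set n0 q0 r0 fv vH Hr nS).
move=> x0 [_ nleave].
have [x [xx0 xf stay]] : exists x, [/\ x 0%N = x0, subgradient_method ip f a x &
    forall k, ipball ip xstar e (x k)].
  apply: contrapT => nex; apply: nleave => x xx0 xf.
  by apply: contrapT => nk; apply: nex; exists x; split => // k;
    apply: contrapT => nb; apply: nk; exists k.
exists x; apply: contrapT => nS'.
have xS k : ~ S (x k).
  move=> Sk; apply: nS'; exists k; split => //; split => //.
  by have [] := ballU _ (stay k).
have [c c0 Hc] := C_incr a a0.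
have xUS k : (U `\` S) (x k) by split => //; have [] := ballU _ (stay k).
have incr k : c * rdist ip S (x k) `^ theta1 <= C (x k.+1) - C (x k).
  by have := Hc x xUS xf k; rewrite rdistE// poweR_EFin -EFinM lee_fin.
have dpos k : 0 < rdist ip S (x k).
  have [_ Wk _ _] := ballU _ (stay k).
  exact: (rdist_gt0 ip S0 dphi (differentiable_continuous (c1.1 _ Wk)) Wk (xS k)).
have bnd k : C (x k) <= C xstar + 1 by have [_ _ /ltW] := ballU _ (stay k).
have mono k : C (x k) <= C (x k.+1).
  by rewrite -subr_ge0; apply: le_trans (incr k); rewrite mulr_ge0 ?powR_ge0// ltW.
have [t0|[eta eta0 Heta]] := He1 a a0.
  apply: (@bounded_increments R (C \o x) (C xstar + 1) c) => // k; exists k => //=.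
  by have := incr k; rewrite t0 powRr0 mulr1; lra.
have ceta0 : 0 < c * eta `^ theta1 by rewrite mulr_gt0// powR_gt0.
apply: (@bounded_increments R (C \o x) (C xstar + 1) (c * eta `^ theta1)) => //= k.
have [j kj dj] : exists2 j, (k <= j)%N & eta <= rdist ip S (x j).
  (* Otherwise the distance to S doubles at each step from k on. *)
  apply: contrapT => nj.
  have small j : (k <= j)%N -> rdist ip S (x j) < eta.
    by move=> kj; rewrite ltNge; apply/negP => ?; apply: nj; exists j.
  have dbl j : (k <= j)%N -> 2 * rdist ip S (x j) <= rdist ip S (x j.+1).
    move=> kj; have [s xs xE] := xf j.
    have [_ _ _ b1] := ballU _ (stay j).
    have [_ _ _ b2] := ballU _ (stay j.+1).
    by rewrite xE in b2 *; apply: Heta => //; exact: small.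
  have grow i : (i.+1)%:R * rdist ip S (x k) <= rdist ip S (x (k + i)%N).
    elim: i => [|i IH]; first by rewrite mul1r addn0.
    rewrite addnS -natr1 mulrDl mul1r; apply: le_trans (dbl _ (leq_addr _ _)).
    have h0 : 0 <= i%:R * rdist ip S (x k) by rewrite mulr_ge0// ltW.
    move: IH; rewrite -natr1; lra.
  have dk := dpos k.
  have := truncnS_gt (eta / rdist ip S (x k)); rewrite ltr_pdivrMr// => h.
  have := grow (Num.truncn (eta / rdist ip S (x k))).
  have := small _ (leq_addr (Num.truncn (eta / rdist ip S (x k))) k); lra.
exists j => //; have := incr j.
have : c * eta `^ theta1 <= c * rdist ip S (x j) `^ theta1.
  rewrite ler_wpM2l ?(ltW c0)// ge0_ler_powR ?nnegrE//; first exact: ltW.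
  exact: rdist_ge0.
lra.
Qed.
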